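(* Let $n\ge k\ge 2$. For any $\boldsymbol\lambda\in\mathcal A_{k+1}(n+1)$, the assignments $s'_i\mapsto w_\circ^{J_i(\boldsymbol\lambda)}$, $i\in[1,k]$, define a locally injective connected homomorphism of Hecke monoids $\psi_{\boldsymbol\lambda}:(W(A_k),\star)\to(W(A_n),\star)$. Moreover, if $\phi:(W(A_k),\star)\to(W(A_n),\star)$ is a locally injective, connected and fully supported homomorphism of Hecke monoids then, up to compositions with diagram automorphisms, $\phi=\psi_{\boldsymbol\lambda}$ for some $\boldsymbol\lambda\in\mathcal A_{k+1}(n+1)$.
   Context: For integers $a,b$ write $[a,b]=\{i\in\mathbb Z: a\le i\le b\}$. $A_n$ denotes the Coxeter matrix over $[1,n]$ with $m_{i,i+1}=3$ and $m_{ij}=2$ for $|i-j|>1$. For a Coxeter matrix $M=(m_{ij})$ over a finite set $I$, the Hecke monoid $(W(M),\star)$ is generated by $s_i$, $i\in I$, subject to $s_i\star s_i=s_i$ and $s_i\star s_j\star\cdots=s_j\star s_i\star\cdots$ ($m_{ij}$ factors on each side) for $i\neq j$ with $m_{ij}<\infty$; its underlying set is identified with the Coxeter group $W(M)$ (a reduced word being sent to the $\star$-product of its letters). For $J\subset I$, $W_J(M)$ is the subgroup generated by $s_j$, $j\in J$; if it is finite, $w_\circ^J$ is its longest element. Generators of the domain are denoted $s'_i$. Homomorphisms of monoids preserve identity elements. For a homomorphism of Hecke monoids $\phi:(W(M'),\star)\to(W(M),\star)$, with $M'$ over $I'$ and $M$ over $I$, let $[\phi](i)$ be the support of $\phi(s'_i)$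 (the set of indices occurring in a reduced expression) and $[\phi](J)=\bigcup_{j\in J}[\phi](j)$. $\phi$ is: locally injective if its restriction to $W_{\{i,j\}}(M')$ is injective for all $i\ne j\in I'$; fully supported if $[\phi](I')=I$; connected if $[\phi](J)$ is a connected subset of $I$ for every connected $J\subset I'$, where a subset is connected if it induces a connected subgraph of the Coxeter graph (vertices $i,j$ joined iff $m_{ij}>2$). A diagram automorphism is the automorphism induced by a permutation $\sigma$ of $I$ with $m_{\sigma(i)\sigma(j)}=m_{ij}$; the non-trivial one for $A_n$ is $s_i\mapsto s_{n+1-i}$. ''Up to compositions with diagram automorphisms'' refers to diagram automorphisms of the domain and the codomain. For $m,r\in\mathbb Z_{>0}$ put $$\mathcal A_r(m)=\{(\lambda_1,\dots,\lambda_r)\in\mathbb Z_{>0}^r: \lambda_1=\dots=\lambda_{r-2}\ge\lambda_{r-1}\ge\lambda_r,\ \textstyle\sum_{j=1}^r\lambda_j=m\}.$$ For $\boldsymbol\lambda=(\lambda_1,\dots,\lambda_r)$ put $a_0(\boldsymbol\lambda)=0$, $a_i(\boldsymbol\lambda)=\lambda_r+\sum_{1\le j\le i-1}\lambda_j$ for $i\in[1,r]$, and $J_i(\boldsymbol\lambda)=[a_{i-1}(\boldsymbol\lambda)+1,a_{i+1}(\boldsymbol\lambda)-1]$ for $i\in[1,r-1]$. *)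

(* Defs.v *)
From HB Require Import structures.
From mathcomp Require Import all_boot perm.
From mathcomp Require Import boolp classical_sets.

Set Implicit Arguments.
Unset Strict Implicit.
Unset Printing Implicit Defensive.

Local Open Scope quotient_scope.
Local Open Scope nat_scope.

(* Monoid presented by the generators I and the relations u = v for R u v:
   words over I modulo the congruence generated by R. *)
Inductive pres_eq (I : Type) (R : seq I -> seq I -> Prop) :
    seq I -> seq I -> Prop :=
| pres_rel u v of R u v : pres_eq R u v
| pres_refl u : pres_eq R u u
| pres_sym u v of pres_eq R u v : pres_eq R v u
| pres_trans u v w of pres_eq R u v & pres_eq R v w : pres_eq R u w
| pres_cat u u' v v' of pres_eq R u u' & pres_eq R v v' :
    pres_eq R (u ++ v) (u' ++ v').

Section PresentedMonoid.
Variables (I : finType) (R : seq I -> seq I -> Prop).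

Definition pres_eqb : rel (seq I) := fun u v => `[< pres_eq R u v >].

Lemma pres_eqb_refl : reflexive pres_eqb.
Proof. by move=> u; apply/asboolP; exact: pres_refl. Qed.

Lemma pres_eqb_sym : symmetric pres_eqb.
Proof. by move=> u v; apply/asboolP/asboolP; exact: pres_sym. Qed.

Lemma pres_eqb_trans : transitive pres_eqb.
Proof.
by move=> v u w /asboolP uv /asboolP vw; apply/asboolP; apply: pres_trans uv vw.
Qed.

Canonical pres_equiv :=
  EquivRel pres_eqb pres_eqb_refl pres_eqb_sym pres_eqb_trans.

Definition pmonoid := {eq_quot pres_equiv}.
HB.instance Definition _ := EqQuotient.on pmonoid.
HB.instance Definition _ := Choice.on pmonoid.

Definition pclass (u : seq I) : pmonoid := \pi_pmonoid u.
Definition pmul (x y : pmonoid) : pmonoid := pclass (repr x ++ repr y).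

Lemma pclassP u v : pclass u = pclass v <-> pres_eq R u v.
Proof.
rewrite /pclass; split=> [/eqP|uv]; first by rewrite piE => /asboolP.
by apply/eqP; rewrite piE; apply/asboolP.
Qed.

Lemma pclass_repr x : pclass (repr x) = x.
Proof. exact: reprK. Qed.

Lemma pclass_cat u v : pclass (u ++ v) = pmul (pclass u) (pclass v).
Proof.
by apply/pclassP; apply: pres_cat; apply/pclassP; rewrite pclass_repr.
Qed.

Lemma pmulA : associative pmul.
Proof.
move=> x y z; rewrite -(pclass_repr x) -(pclass_repr y) -(pclass_repr z).
by rewrite -!pclass_cat catA.
Qed.

Lemma pmul1 : left_id (pclass [::]) pmul.
Proof. by move=> x; rewrite -(pclass_repr x) -pclass_cat. Qed.

Lemma pmulr1 : right_id (pclass [::]) pmul.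
Proof. by move=> x; rewrite -(pclass_repr x) -pclass_cat cats0. Qed.

HB.instance Definition _ := isMonoid.Build pmonoid pmulA pmul1 pmulr1.

End PresentedMonoid.

(* m i j = 0 encodes m i j = oo. *)
Record coxeter_matrix (I : finType) := CoxeterMatrix {
  cox_m :> I -> I -> nat;
  cox_m_diag : forall i, cox_m i i = 1;
  cox_m_sym : forall i j, cox_m i j = cox_m j i;
  cox_m_offdiag : forall i j, i != j -> cox_m i j != 1 }.

Section CoxeterGroup.
Variables (I : finType) (M : coxeter_matrix I).

(* (s_i s_j)^(m i j) = 1, which includes s_i s_i = 1 since m i i = 1;
   the relation is void when m i j = 0, i.e. oo. *)
Inductive cox_rel : seq I -> seq I -> Prop :=
| CoxRel i j : cox_rel (flatten (nseq (M i j) [:: i; j])) [::].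

Definition cox := pmonoid cox_rel.
HB.instance Definition _ := Monoid.on cox.

Definition cox_word (u : seq I) : cox := pclass cox_rel u.
Definition cox_inv (x : cox) : cox := cox_word (rev (repr x)).

Lemma cox_eq_rev u v :
  pres_eq cox_rel u v -> pres_eq cox_rel (rev u) (rev v).
Proof.
elim=> {u v} [_ _ [i j]|u|u v _|u v w _ uv _|u u' v v' _ uu' _ vv'].
- have -> : rev (flatten (nseq (M i j) [:: i; j])) =
            flatten (nseq (M j i) [:: j; i]).
    rewrite cox_m_sym; elim: (cox_m M j i) => //= m IHm.
    rewrite !rev_cons IHm -!cats1 -catA /=.
    by elim: m {IHm} => //= m ->.
  exact/pres_rel/CoxRel.
- exact: pres_refl.
- exact: pres_sym.
- exact: pres_trans.
- by rewrite !rev_cat; apply: pres_cat.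
Qed.

Lemma cox_eq_rev_cat u : pres_eq cox_rel (rev u ++ u) [::].
Proof.
elim: u => [|i u IHu]; first exact: pres_refl.
rewrite rev_cons -cats1 -catA -(cat1s i u) (catA [:: i]).
apply: pres_trans IHu; apply: pres_cat; first exact: pres_refl.
rewrite -[X in pres_eq _ _ X]cat0s; apply: pres_cat; last exact: pres_refl.
by have := CoxRel i i; rewrite cox_m_diag => /pres_rel.
Qed.

Lemma cox_mulVg (x : cox) : (cox_inv x * x = 1)%g.
Proof.
rewrite -{2}(pclass_repr x) /cox_inv /cox_word.
by rewrite -[LHS]pclass_cat; apply/pclassP/cox_eq_rev_cat.
Qed.

Lemma cox_mulgV (x : cox) : (x * cox_inv x = 1)%g.
Proof.
rewrite -{1}(pclass_repr x) /cox_inv /cox_word -[LHS]pclass_cat.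
apply/pclassP; rewrite -{1}(revK (repr x)); exact: cox_eq_rev_cat.
Qed.

HB.instance Definition _ := hasInv.Build cox cox_inv.
HB.instance Definition _ := Monoid_isGroup.Build cox cox_mulVg cox_mulgV.

Definition cox_gen (i : I) : cox := cox_word [:: i].

Lemma cox_has_word (w : cox) :
  exists l, `[< exists2 u, cox_word u = w & size u = l >].
Proof.
by exists (size (repr w)); apply/asboolP; exists (repr w) => //; exact: reprK.
Qed.

Definition cox_length (w : cox) : nat := ex_minn (cox_has_word w).

Definition reduced_word (w : cox) (u : seq I) : Prop :=
  cox_word u = w /\ size u = cox_length w.

(* The subgroup W_J. *)
Inductive parabolic (J : {set I}) : cox -> Prop :=
| Parabolic_gen j of j \in J : parabolic J (cox_gen j)
| Parabolic_1 : parabolic J 1%g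
| Parabolic_mul x y of parabolic J x & parabolic J y : parabolic J (x * y)%g
| Parabolic_inv x of parabolic J x : parabolic J x^-1%g.

Definition is_longest (J : {set I}) (w : cox) : Prop :=
  parabolic J w /\ forall v, parabolic J v -> cox_length v <= cox_length w.

(* The default value 1 is only taken when W_J is infinite. *)
Definition w0 (J : {set I}) : cox := xget 1%g (is_longest J).

Definition cox_edge : rel I :=
  fun i j => (M i j == 0) || (2 < M i j).

(* The empty set counts as connected. *)
Definition connected_set (J : {set I}) : Prop :=
  forall i j, i \in J -> j \in J ->
    connect (fun a b => [&& a \in J, b \in J & cox_edge a b]) i j.

End CoxeterGroup.

Section HeckeMonoid.
Variables (I : finType) (M : coxeter_matrix I).

Fixpoint alternating (l : nat) (i j : I) : seq I :=
  if l is l'.+1 then i :: alternating l' j i else [::].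

(* The braid relation is void when M i j = 0, i.e. oo. *)
Inductive hecke_rel : seq I -> seq I -> Prop :=
| Hecke_idem i : hecke_rel [:: i; i] [:: i]
| Hecke_braid i j of i != j :
    hecke_rel (alternating (M i j) i j) (alternating (M i j) j i).

Definition hecke := pmonoid hecke_rel.
HB.instance Definition _ := Monoid.on hecke.

Definition hecke_word (u : seq I) : hecke := pclass hecke_rel u.
Definition hecke_gen (i : I) : hecke := hecke_word [:: i].

(* The identification of W(M) with the Hecke monoid: a reduced word of w is
   sent to the star product of its letters (the choice of the reduced word is
   immaterial by Matsumoto's theorem). *)
Definition hecke_of_cox (w : cox M) : hecke :=
  hecke_word (xget [::] (reduced_word w)).

Definition supp (x : hecke) : {set I} :=
  [set i | `[< exists w u,
    [/\ hecke_of_cox w = x, reduced_word w u & i \in u] >]]%SET.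

End HeckeMonoid.

Notation hecke_hom M' M :=
  (UMagmaMorphism.type (hecke M') (hecke M)).

Section HeckeHom.
Variables (I' I : finType) (M' : coxeter_matrix I') (M : coxeter_matrix I).
Variable phi : hecke_hom M' M.

Definition supp_hom (J : {set I'}) : {set I} :=
  (\bigcup_(j in J) supp (phi (hecke_gen M' j)))%SET.

Definition locally_injective : Prop :=
  forall i j : I', i != j ->
  forall v w : cox M',
    parabolic [set i; j]%SET v -> parabolic (i |: [set j])%SET w ->
    phi (hecke_of_cox v) = phi (hecke_of_cox w) ->
    hecke_of_cox v = hecke_of_cox w.

Definition fully_supported : Prop := supp_hom [set: I']%SET = [set: I]%SET.

Definition connected_hom : Prop :=
  forall J : {set I'}, connected_set M' J -> connected_set M (supp_hom J).

End HeckeHom.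

Definition diagram_automorphism (I : finType) (M : coxeter_matrix I)
    (d : hecke_hom M M) : Prop :=
  exists sigma : {perm I}, (forall i j, M (sigma i) (sigma j) = M i j) /\
    forall i, d (hecke_gen M i) = hecke_gen M (sigma i).

(* i : 'I_n stands for the index i.+1 of [1, n]. *)
Definition cox_A_m (n : nat) (i j : 'I_n) : nat :=
  if i == j then 1 else if (i.+1 == j) || (j.+1 == i) then 3 else 2.

Lemma cox_A_diag n (i : 'I_n) : cox_A_m i i = 1.
Proof. by rewrite /cox_A_m eqxx. Qed.

Lemma cox_A_sym n (i j : 'I_n) : cox_A_m i j = cox_A_m j i.
Proof. by rewrite /cox_A_m eq_sym orbC. Qed.

Lemma cox_A_offdiag n (i j : 'I_n) : i != j -> cox_A_m i j != 1.
Proof. by rewrite /cox_A_m => /negPf ->; case: ifP. Qed.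

Definition cox_A (n : nat) : coxeter_matrix 'I_n :=
  CoxeterMatrix (@cox_A_diag n) (@cox_A_sym n) (@cox_A_offdiag n).

Section Lambda.
Variables (r : nat) (lam : r.-tuple nat).

(* 1-based: part j = lambda_j for 1 <= j <= r. *)
Definition part (j : nat) : nat := nth 0 lam j.-1.

Definition in_calA (m : nat) : bool :=
  [&& all (leq 1) lam, constant (take (r - 2) lam), sorted geq lam
    & sumn lam == m].

Definition a_ (i : nat) : nat :=
  if i == 0 then 0 else part r + \sum_(1 <= j < i) part j.

(* J_ n i = J_i(lambda) as a subset of [1, n], for 1 <= i <= r - 1. *)
Definition J_ (n i : nat) : {set 'I_n} :=
  [set j : 'I_n | a_ i.-1 + 1 <= j.+1 <= a_ i.+1 - 1]%SET.

End Lambda.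

(* psi is given by s'_i |-> w0 (J_i(lambda)), 1 <= i <= k. *)
Definition is_psi (k n : nat) (lam : k.+1.-tuple nat)
    (psi : hecke_hom (cox_A k) (cox_A n)) : Prop :=
  forall i : 'I_k,
    psi (hecke_gen (cox_A k) i) = hecke_of_cox (w0 (cox_A n) (J_ lam n i.+1)).

(* Main.v *)
(* The generator s_i of the Hecke monoid of type A_n acts on functions of the
   positions 0, ..., n by sorting the values at i and i + 1 decreasingly, and by
   Matsumoto's theorem an element is determined by its action on the identity
   function. An idempotent is the w_0^J of its support J, since it absorbs
   every letter of J; if J is an interval, it acts by sorting a block of
   consecutive positions. So psi_lambda and every connected phi are described
   by k blocks of positions.

   Sorting blocks commutes when they are disjoint, and by the 0-1 principle it
   does not when they overlap properly. If A B and B C are overlapping blocks,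
   then AB, BC, AB sorts A B C completely when |C| <= |B|, and BC, AB, BC does
   when |A| <= |B|, so the braid relation holds under both conditions; conversely
   counting ones shows that it forces both. Local injectivity excludes nested
   blocks, so blocks i and i + 1 overlap in this way, blocks i and j with
   |i - j| > 1 are disjoint, and the blocks are ordered from left to right or
   from right to left. The overlaps with the two neighbours are then disjoint
   in every inner block, and the inequalities between their lengths are forced
   to be equalities. *)
From HB Require Import structures.
Require Import Defs.
From mathcomp Require Import all_boot perm.
From mathcomp Require Import boolp zify.

Set Implicit Arguments.
Unset Strict Implicit.
Unset Printing Implicit Defensive.

Local Open Scope nat_scope.

(** * Reduced words in the symmetric group *)

Definition transp (p q x : nat) : nat :=
  if x == p then q else if x == q then p else x.

Lemma transpK p q : involutive (transp p q).
Proof. by move=> x; rewrite /transp; do !case: ifP; lia. Qed.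

(** Taking for [t] a simple transposition, this conjugation rule yields both the commutation and the
    braid identity of [strans], and it carries [exchange] past one letter. *)
Lemma transp_conj p q (t : nat -> nat) :
  injective t -> t \o transp p q = transp (t p) (t q) \o t.
Proof.
move=> t_inj; apply: funext => x; rewrite /transp /= !(inj_eq t_inj).
by do !case: ifP.
Qed.

Local Notation strans i := (transp i i.+1).

Lemma strans_comp2 i (f : nat -> nat) : (f \o strans i) \o strans i = f.
Proof. by apply: funext => x /=; rewrite transpK. Qed.

Lemma strans_l i : strans i i = i.+1.
Proof. by rewrite /transp eqxx. Qed.

Lemma strans_r i : strans i i.+1 = i.
Proof. by rewrite /transp eqn_leq ltnn /= eqxx. Qed.

Lemma strans_far i p : (p < i) || (i.+1 < p) -> strans i p = p.
Proof. by rewrite /transp; do !case: ifP; lia. Qed.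

Lemma strans_comm i j x : i.+1 < j ->
  strans i (strans j x) = strans j (strans i x).
Proof.
move=> ij; have /(congr1 (@^~ x)) /= :=
  @transp_conj j j.+1 _ (can_inj (transpK i i.+1)).
by move=> ->; rewrite (@strans_far i j) ?(@strans_far i j.+1) //; lia.
Qed.

Lemma strans_braid i x :
  strans i (strans i.+1 (strans i x)) = strans i.+1 (strans i (strans i.+1 x)).
Proof.
have /(congr1 (@^~ (strans i x))) /= :=
  @transp_conj i.+1 i.+2 _ (can_inj (transpK i i.+1)).
have /(congr1 (@^~ (strans i.+1 x))) /= :=
  @transp_conj i i.+1 _ (can_inj (transpK i.+1 i.+2)).
rewrite !transpK !strans_r !strans_l => -> ->.
by rewrite (@strans_far i i.+2) ?(@strans_far i.+1 i) ?ltnSn ?orbT.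
Qed.

(* The letter i : 'I_n stands for the transposition of the positions i and i.+1
   among 0, ..., n. *)
Section Words.
Variable n : nat.
Implicit Types (u v : seq 'I_n) (f : nat -> nat).

(** The leftmost letter is outermost, so appending a letter on the right exchanges two positions and
    leaves the values alone. *)
Definition wperm u : nat -> nat := foldr (fun (i : 'I_n) f => strans i \o f) id u.

Lemma wperm_cat u v : wperm (u ++ v) = wperm u \o wperm v.
Proof. by elim: u => //= i u ->. Qed.

Lemma wperm_rcons u i : wperm (rcons u i) = wperm u \o strans i.
Proof. by rewrite -cats1 wperm_cat. Qed.

Lemma wperm_inj u : injective (wperm u).
Proof. by elim: u => [|i u IHu] //= x y /(can_inj (transpK _ _)) /IHu. Qed.

(* Following the values of u at p and q back through u, some letter of u swaps
   them; v is u without that letter. *)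
Lemma exchange u p q : p < q -> wperm u q < wperm u p ->
  exists v, [/\ (size v).+1 = size u, {subset v <= u}
              & wperm v = wperm u \o transp p q].
Proof.
elim/last_ind: u p q => [|u j IHu] p q pq; first by move=> /=; lia.
rewrite wperm_rcons /= => upq.
have [/andP[/eqP pj /eqP qj]|pqj] := boolP ((p == j) && (q == j.+1)).
  exists u; split; first by rewrite size_rcons.
    by move=> x xu; rewrite mem_rcons inE xu orbT.
  by rewrite pj qj strans_comp2.
have pq' : strans j p < strans j q.
  by move: pqj pq; rewrite /transp; do !case: ifP; lia.
have [v [sv vu vE]] := IHu _ _ pq' upq.
exists (rcons v j); split; first by rewrite !size_rcons sv.
  move=> x; rewrite !mem_rcons !inE => /orP[->//|/vu ->]; by rewrite orbT.
rewrite wperm_rcons vE; apply: funext => x /=.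
congr (wperm u _).
have /(congr1 (@^~ x)) /= := @transp_conj p q _ (can_inj (transpK j j.+1)).
by move=> ->.
Qed.

(** The number of inversions among the positions 0, ..., n; on [wperm u] it is the Coxeter length,
    see [cox_lengthE]. *)
Definition inv f : nat :=
  \sum_(p < n.+1) \sum_(q < n.+1) ((p < q) && (f q < f p)).

Lemma inv_id : inv id = 0.
Proof. by rewrite /inv big1 // => p _; rewrite big1 // => q _; lia. Qed.

(** Moving both positions by the transposition permutes the pairs of positions and keeps the order
    inside every pair other than i, i+1. Hence exactly one inversion is created, at the pair
    [x0]. *)
Lemma inv_ascent f (i : 'I_n) : f i < f i.+1 -> inv (f \o strans i) = (inv f).+1.
Proof.
move=> fi.
have t_lt (p : 'I_n.+1) : strans i p < n.+1.
  by rewrite /transp; have := ltn_ord i; have := ltn_ord p; do !case: ifP; lia.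
pose t (p : 'I_n.+1) := Ordinal (t_lt p).
have tK : involutive t by move=> p; apply: val_inj; rewrite /= transpK.
have i_lt : i < n.+1 by have := ltn_ord i; lia.
have i1_lt : i.+1 < n.+1 by have := ltn_ord i; lia.
pose x0 := (Ordinal i1_lt, Ordinal i_lt).
rewrite /inv !pair_big /=.
have t2_inj : injective (fun x : 'I_n.+1 * 'I_n.+1 => (t x.1, t x.2)).
  by move=> [a b] [c d] /= [ac bd]; congr pair;
    apply: (can_inj tK); apply: val_inj.
rewrite (reindex_inj t2_inj) /= (bigD1 x0) //= [X in _ = X.+1](bigD1 x0) //=.
rewrite !transpK strans_l strans_r ltnSn fi /= ltnNge leqnSn /= add0n.
rewrite add1n; congr S; apply: eq_bigr => -[p q] /= /eqP pq.
rewrite !transpK; congr nat_of_bool.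
have [/andP[/eqP pi /eqP qi]|npq] := boolP ((p == i :> nat) && (q == i.+1 :> nat)).
  by rewrite pi qi strans_l strans_r; lia.
have npq' : ~~ ((p == i.+1 :> nat) && (q == i :> nat)).
  apply/negP => /andP[/eqP pi /eqP qi]; apply: pq.
  by congr pair; apply: val_inj.
suff -> : (strans i p < strans i q) = (p < q) by [].
by move: npq npq'; rewrite /transp; do !case: ifP; lia.
Qed.

Lemma inv_descent f (i : 'I_n) : f i.+1 < f i -> inv f = (inv (f \o strans i)).+1.
Proof.
move=> fi; rewrite -{1}(strans_comp2 i f) inv_ascent //=.
by rewrite strans_l strans_r.
Qed.

Definition reduced u := inv (wperm u) == size u.

Lemma wperm_descent u (i : nat) :
  (wperm u i.+1 < wperm u i) = ~~ (wperm u i < wperm u i.+1).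
Proof.
rewrite -leqNgt [RHS]leq_eqVlt; case: eqP => // /(@wperm_inj u); lia.
Qed.

Lemma inv_wperm_le u : inv (wperm u) <= size u.
Proof.
elim/last_ind: u => [|u i IHu]; first by rewrite inv_id.
rewrite wperm_rcons size_rcons.
have [lt|] := boolP (wperm u i < wperm u i.+1); first by rewrite inv_ascent.
by rewrite -wperm_descent => /inv_descent; lia.
Qed.

Lemma reduced_rcons u (i : 'I_n) :
  reduced (rcons u i) = reduced u && (wperm u i < wperm u i.+1).
Proof.
rewrite /reduced wperm_rcons size_rcons.
have [lt|] := boolP (wperm u i < wperm u i.+1).
  by rewrite inv_ascent // andbT eqSS.
rewrite -wperm_descent => /inv_descent; rewrite andbF.
by have := inv_wperm_le u; lia.
Qed.

(** Exchange removes one letter while a descent lowers [inv] by one, so [v] stays reduced; putting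
    [i] back at the end is then an ascent. *)
Lemma reduced_exchange u (i : 'I_n) : reduced u -> wperm u i.+1 < wperm u i ->
  exists v, [/\ reduced v, {subset v <= u}, wperm v = wperm u \o strans i
    & reduced (rcons v i) /\ wperm (rcons v i) = wperm u].
Proof.
move=> ru ui; have [v [sv vu vE]] := exchange (ltnSn i) ui.
have rv : reduced v.
  by move: ru; rewrite /reduced vE (inv_descent ui) -sv eqSS.
exists v; split=> //; split; last by rewrite wperm_rcons vE strans_comp2.
by rewrite reduced_rcons rv vE /= strans_l strans_r.
Qed.

(** * Matsumoto's theorem in type A *)

Section Matsumoto.
Variable R : seq 'I_n -> seq 'I_n -> Prop.
Hypothesis braid : forall i j : 'I_n, i != j ->
  pres_eq R (alternating (cox_A n i j) i j) (alternating (cox_A n i j) j i).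

(** Induction on the length. Words with the same last letter are compared through their prefixes. If
    the last letters differ, both are descents of the permutation, which therefore has reduced words
    ending in the two sides of the braid relation; these link [u] to [v]. [R] stays abstract so that
    the Coxeter and the Hecke presentations are both covered. *)
Lemma matsumoto u v :
  reduced u -> reduced v -> wperm u = wperm v -> pres_eq R u v.
Proof.
have catR w a b : pres_eq R a b -> pres_eq R (w ++ a) (w ++ b).
  by move=> ab; apply: pres_cat => //; exact: pres_refl.
have [m] := ubnP (size u); elim: m u v => // m IHm u v.
have IH a b i : size (rcons a i) <= m -> reduced (rcons a i) ->
    reduced b -> wperm b = wperm (rcons a i) \o strans i ->
    pres_eq R (rcons a i) (rcons b i).
  rewrite size_rcons wperm_rcons strans_comp2 reduced_rcons.
  move=> sa /andP[ra _] rb ba; rewrite -!cats1.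
  by apply: pres_cat; [apply: IHm|exact: pres_refl].
have size_eq a b : reduced a -> reduced b -> wperm a = wperm b -> size a = size b.
  by rewrite /reduced => /eqP <- /eqP <- ->.
case/lastP: u => [|u i] + + rv.
  move=> _ _ v1; have := size_eq _ _ rv (_ : reduced [::]) (esym v1).
  rewrite /reduced /= inv_id eqxx => /(_ isT) /size0nil ->; exact: pres_refl.
rewrite ltnS => szu ru uv.
have := size_eq _ _ ru rv uv; case/lastP: v => [|v j] in rv uv *.
  by rewrite size_rcons.
move=> suv.
have [ij|ij] := eqVneq i j.
  rewrite -ij in rv uv suv *; apply: IH => //.
    by move: rv; rewrite reduced_rcons => /andP[].
  by rewrite uv wperm_rcons strans_comp2.
have di : wperm (rcons u i) i.+1 < wperm (rcons u i) i.
  move: ru; rewrite reduced_rcons => /andP[_].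
  by rewrite wperm_rcons /= strans_l strans_r.
have dj : wperm (rcons u i) j.+1 < wperm (rcons u i) j.
  move: rv; rewrite uv reduced_rcons => /andP[_].
  by rewrite wperm_rcons /= strans_l strans_r.
have szv : size (rcons v j) <= m by rewrite -suv.
(* It suffices to find reduced words of the common permutation ending in the
   two sides of the braid relation. *)
suff [a [b [ra rb eqab pa pb]]] : exists a b,
    [/\ reduced (rcons a i), reduced (rcons b j),
        pres_eq R (rcons a i) (rcons b j), wperm (rcons a i) = wperm (rcons u i)
      & wperm (rcons b j) = wperm (rcons u i)].
  apply: (pres_trans (v := rcons a i)).
    apply: IH => //; first by move: ra; rewrite reduced_rcons => /andP[].
    by rewrite -pa wperm_rcons strans_comp2.
  apply: pres_trans eqab _; apply: pres_sym; apply: IH => //.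
    by move: rb; rewrite reduced_rcons => /andP[].
  by rewrite -uv -pb wperm_rcons strans_comp2.
move: (rcons u i) ru di dj => g rg di dj {IH IHm szu suv uv u v szv rv}.
wlog ltij : i j ij di dj / i < j.
  move=> H; case: (ltngtP i j) => [|ji|/val_inj /eqP]; first by apply: H.
    have [b [a [rb ra eqab pb pa]]] := H j i (negbT (ltn_eqF ji)) dj di ji.
    by exists a, b; split=> //; apply: pres_sym.
  by rewrite (negPf ij).
have := braid ij; rewrite /= /cox_A_m (negPf ij) (gtn_eqF (leqW ltij)) orbF.
have [ji|ji] /= := eqVneq i.+1 j => eqij.
  (* Adjacent letters: removing the descents i, j, i in turn leaves a word [c], and both c i j i and
     c j i j are reduced words of the permutation of [g]. *)
  have [a [ra _ aE _]] := reduced_exchange rg di.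
  have aj : wperm a j.+1 < wperm a j.
    rewrite aE /= -ji strans_r strans_far ?ltnSn ?orbT // ji.
    by move: di; rewrite ji; lia.
  have [b [rb _ bE _]] := reduced_exchange ra aj.
  have bi : wperm b i.+1 < wperm b i.
    rewrite bE aE /= -ji strans_l (@strans_far i.+1 i) ?ltnSn // strans_l.
    by rewrite strans_far ?ltnSn ?orbT // ji.
  have [c [rc _ cE _]] := reduced_exchange rb bi.
  have pE w : wperm w = wperm g -> reduced w = (size g == size w).
    by move=> wg; rewrite /reduced wg (eqP rg).
  have size_c : size g = (size c).+3.
    rewrite -(eqP rg) -(eqP rc) (inv_descent di) -aE (inv_descent aj) -bE.
    by rewrite (inv_descent bi) -cE.
  have ci : wperm (c ++ [:: i; j; i]) = wperm g.
    by rewrite wperm_cat cE bE aE; apply: funext => x /=; rewrite !transpK.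
  have cj : wperm (c ++ [:: j; i; j]) = wperm g.
    by rewrite -ci !wperm_cat; apply: funext => x /=; rewrite -ji strans_braid.
  exists (c ++ [:: i; j]), (c ++ [:: j; i]); rewrite !rcons_cat.
  by split=> //; rewrite ?pE // ?size_cat ?size_c ?addn3 //; apply: catR.
have [a [ra _ aE _]] := reduced_exchange rg di.
have aj : wperm a j.+1 < wperm a j by rewrite aE /= !strans_far //; lia.
have [b [rb _ bE _]] := reduced_exchange ra aj.
have pE w : wperm w = wperm g -> reduced w = (size g == size w).
  by move=> wg; rewrite /reduced wg (eqP rg).
have size_b : size g = (size b).+2.
  by rewrite -(eqP rg) -(eqP rb) (inv_descent di) -aE (inv_descent aj) -bE.
have bi : wperm (b ++ [:: j; i]) = wperm g.
  by rewrite wperm_cat bE aE; apply: funext => x /=; rewrite !transpK.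
have bj : wperm (b ++ [:: i; j]) = wperm g.
  by rewrite -bi !wperm_cat; apply: funext => x /=; rewrite strans_comm //; lia.
exists (b ++ [:: j]), (b ++ [:: i]); rewrite !rcons_cat.
split=> //; rewrite ?pE ?size_cat ?size_b ?addn2 //.
by apply: catR; apply: pres_sym.
Qed.

End Matsumoto.
End Words.

(** * The Hecke monoid and its action by sorting *)

Definition bubble (i : nat) (f : nat -> nat) (p : nat) : nat :=
  if p == i then maxn (f i) (f i.+1)
  else if p == i.+1 then minn (f i) (f i.+1) else f p.

Lemma bubble_l i f : bubble i f i = maxn (f i) (f i.+1).
Proof. by rewrite /bubble eqxx. Qed.

Lemma bubble_r i f : bubble i f i.+1 = minn (f i) (f i.+1).
Proof. by rewrite /bubble eqn_leq ltnn /= eqxx. Qed.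

Lemma bubble_far i f p : (p < i) || (i.+1 < p) -> bubble i f p = f p.
Proof. by rewrite /bubble; do !case: ifP; lia. Qed.

Lemma bubble_ascent i f : f i < f i.+1 -> bubble i f = f \o strans i.
Proof.
move=> fi; apply: funext => p; rewrite /bubble /transp /=.
by case: ifP => [|_]; [|case: ifP]; lia.
Qed.

Lemma bubble_descent i f : f i.+1 <= f i -> bubble i f = f.
Proof.
move=> fi; apply: funext => p; rewrite /bubble.
by case: eqP => [->|_]; [|case: eqP => [->|]]; lia.
Qed.

Lemma bubble_idem i f : bubble i (bubble i f) = bubble i f.
Proof. by apply: bubble_descent; rewrite bubble_l bubble_r; lia. Qed.

Lemma bubble_comm i j f : i.+1 < j ->
  bubble i (bubble j f) = bubble j (bubble i f).
Proof.
move=> ij; apply: funext => p.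
have [pi|pi] := boolP ((p == i) || (p == i.+1)).
  have [q ->] : exists q : bool, p = i + q.
    by case/orP: pi => /eqP ->; [exists false|exists true]; lia.
  rewrite [RHS]bubble_far; last by case: q; lia.
  by case: q; rewrite ?addn0 ?addn1 ?bubble_l ?bubble_r !(@bubble_far j) //; lia.
rewrite [LHS]bubble_far; last by lia.
have [pj|pj] := boolP ((p == j) || (p == j.+1)); last first.
  by rewrite !bubble_far //; lia.
case/orP: pj => /eqP ->.
  by rewrite !bubble_l !(@bubble_far i) //; lia.
by rewrite !bubble_r !(@bubble_far i) //; lia.
Qed.

Lemma bubble_braid i f :
  bubble i (bubble i.+1 (bubble i f)) = bubble i.+1 (bubble i (bubble i.+1 f)).
Proof.
have far0 g : bubble i.+1 g i = g i by rewrite bubble_far ?ltnSn.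
have far2 g : bubble i g i.+2 = g i.+2 by rewrite bubble_far ?ltnSn ?orbT.
apply: funext => p.
have [/eqP ->|pi] := boolP (p == i).
  by rewrite !(bubble_l, bubble_r, far0, far2); lia.
have [/eqP ->|pi1] := boolP (p == i.+1).
  by rewrite !(bubble_l, bubble_r, far0, far2); lia.
have [/eqP ->|pi2] := boolP (p == i.+2).
  by rewrite !(bubble_l, bubble_r, far0, far2); lia.
by rewrite !bubble_far //; lia.
Qed.

(** Monotone maps commute with max and min; with threshold maps this reduces sorting to 0-1
    functions. *)
Lemma bubble_comp (g f : nat -> nat) i : {homo g : x y / x <= y} ->
  bubble i (g \o f) = g \o bubble i f.
Proof.
move=> g_mono; have g_max x y : maxn (g x) (g y) = g (maxn x y).
  by case: (leqP x y) => [xy|/ltnW xy]; have := g_mono _ _ xy; lia.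
have g_min x y : minn (g x) (g y) = g (minn x y).
  by case: (leqP x y) => [xy|/ltnW xy]; have := g_mono _ _ xy; lia.
by apply: funext => p; rewrite /bubble /= g_max g_min; do !case: ifP.
Qed.

(** [pres_eq] is the least congruence containing [R]: this is how an invariant of words is shown to
    descend to the presented monoid. *)
Lemma pres_eq_ind_cong (I : Type) (R E : seq I -> seq I -> Prop) :
    (forall u v, R u v -> E u v) -> (forall u, E u u) ->
    (forall u v, E u v -> E v u) ->
    (forall u v w, E u v -> E v w -> E u w) ->
    (forall u u' v v', E u u' -> E v v' -> E (u ++ v) (u' ++ v')) ->
  forall u v, pres_eq R u v -> E u v.
Proof.
move=> RE E_refl E_sym E_trans E_cat u v.
elim=> {u v} [u v /RE|//|u v _ /E_sym|u v w _ uv _ /(E_trans _ _ _ uv)|] //.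
by move=> u u' v v' _ uu' _; apply: E_cat.
Qed.

Section TypeA.
Variable n : nat.
Implicit Types (u v : seq 'I_n) (f : nat -> nat) (i j : 'I_n) (J : {set 'I_n}).

Local Notation W := (cox (cox_A n)).
Local Notation H := (hecke (cox_A n)).
Local Notation hw := (@hecke_word 'I_n (cox_A n)).
Local Notation hs := (@hecke_gen 'I_n (cox_A n)).
Local Notation cw := (@cox_word 'I_n (cox_A n)).
Implicit Types (h g : H) (w : W).

Lemma hecke_wordP u v : hw u = hw v <-> pres_eq (hecke_rel (cox_A n)) u v.
Proof. exact: pclassP. Qed.

Lemma cox_wordP u v : cw u = cw v <-> pres_eq (cox_rel (cox_A n)) u v.
Proof. exact: pclassP. Qed.

Lemma hecke_word0 : hw [::] = 1%g.
Proof. by []. Qed.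

Lemma hecke_word_cat u v : hw (u ++ v) = (hw u * hw v)%g.
Proof. exact: pclass_cat. Qed.

Lemma hecke_word_rcons u i : hw (rcons u i) = (hw u * hs i)%g.
Proof. by rewrite -cats1 hecke_word_cat. Qed.

Lemma hecke_word_cons u i : hw (i :: u) = (hs i * hw u)%g.
Proof. by rewrite -cat1s hecke_word_cat. Qed.

Lemma hecke_word_repr h : hw (repr h) = h.
Proof. exact: pclass_repr. Qed.

Lemma cox_word_cat u v : cw (u ++ v) = (cw u * cw v)%g.
Proof. exact: pclass_cat. Qed.

Lemma cox_word_rcons u i : cw (rcons u i) = (cw u * cox_gen _ i)%g.
Proof. by rewrite -cats1 cox_word_cat. Qed.

Variant cox_A_spec i j : nat -> Type :=
  | CoxAFar of (i.+1 < j) || (j.+1 < i) : cox_A_spec i j 2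
  | CoxANear of (i.+1 == j) || (j.+1 == i) : cox_A_spec i j 3.

Lemma cox_AP i j : i != j -> cox_A_spec i j (cox_A_m i j).
Proof.
move=> ij; have ij' : (i : nat) != j by [].
rewrite /cox_A_m (negPf ij); case: ifP => [|/negbT] ijn; first exact: CoxANear.
by apply: CoxAFar; lia.
Qed.

Lemma hecke_braid i j : i != j ->
  pres_eq (hecke_rel (cox_A n)) (alternating (cox_A n i j) i j)
                                (alternating (cox_A n i j) j i).
Proof. by move=> ij; apply/pres_rel/Hecke_braid. Qed.

Lemma cox_gen2 i : (cox_gen (cox_A n) i * cox_gen _ i = 1)%g.
Proof.
rewrite -cox_word_cat; apply/pclassP; apply: pres_rel.
by have := CoxRel (cox_A n) i i; rewrite cox_m_diag.
Qed.

Lemma cox_genV i : ((cox_gen (cox_A n) i)^-1 = cox_gen _ i)%g.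
Proof. by apply: (@mulgI W (cox_gen _ i)); rewrite mulgV cox_gen2. Qed.

(** Half of the factors of the relation (s_i s_j)^m = 1 are moved to the other side, where each
    generator is its own inverse. *)
Lemma cox_braid i j : i != j ->
  pres_eq (cox_rel (cox_A n)) (alternating (cox_A n i j) i j)
                              (alternating (cox_A n i j) j i).
Proof.
move=> ij; apply/cox_wordP.
have /cox_wordP /= := pres_rel (CoxRel (cox_A n) i j).
have w2 a b : cw [:: a; b] = (cox_gen _ a * cox_gen _ b)%g.
  by rewrite -cat1s cox_word_cat.
have w3 a b c : cw [:: a; b; c] = (cox_gen _ a * cox_gen _ b * cox_gen _ c)%g.
  by rewrite -cat1s cox_word_cat w2 mulgA.
have mul1V (a b : W) : (a * b = 1 -> a = b^-1)%g.
  by move=> ab; apply: (@mulIg W b); rewrite ab mulVg.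
case: (cox_AP ij) => _ /=.
  rewrite -[_ :: _]/([:: i; j] ++ [:: i; j]) cox_word_cat !w2.
  by move/mul1V; rewrite invgM !cox_genV.
rewrite -[_ :: _]/([:: i; j; i] ++ [:: j; i; j]) cox_word_cat !w3.
by move/mul1V; rewrite !invgM !cox_genV mulgA.
Qed.

Lemma hecke_gen2 i : (hs i * hs i = hs i)%g.
Proof. by rewrite -hecke_word_cat; apply/pclassP/pres_rel/Hecke_idem. Qed.

Lemma hecke_gen_comm i j : (i.+1 < j) || (j.+1 < i) -> (hs i * hs j = hs j * hs i)%g.
Proof.
move=> far; have ij : i != j by apply/eqP => ij; move: far; rewrite ij; lia.
have /hecke_wordP := hecke_braid ij; rewrite /= /cox_A_m (negPf ij) ifN; last by lia.
by rewrite -!hecke_word_cat.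
Qed.

(** Letters are appended one at a time. At a descent, Matsumoto's theorem rewrites the current word
    to end in the new letter, and the two copies cancel. *)
Lemma cox_reduced u :
  exists v, [/\ reduced v, {subset v <= u} & cw v = cw u].
Proof.
elim/last_ind: u => [|u i [v [rv vu vE]]].
  by exists [::]; split=> //; rewrite /reduced inv_id.
have [lt|] := boolP (wperm v i < wperm v i.+1).
  exists (rcons v i); split; first by rewrite reduced_rcons rv lt.
    by move=> x; rewrite !mem_rcons !inE => /orP[->//|/vu ->]; rewrite orbT.
  by rewrite !cox_word_rcons vE.
rewrite -wperm_descent => /(reduced_exchange rv) [v' [rv' v'v _ [rv'i v'iE]]].
exists v'; split=> //; first by move=> x /v'v /vu; rewrite mem_rcons inE orbC => ->.
have /cox_wordP := matsumoto cox_braid rv rv'i (esym v'iE).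
rewrite cox_word_rcons => vi.
by rewrite cox_word_rcons -vE vi -mulgA cox_gen2 mulg1.
Qed.

Lemma hecke_reduced_eq u v : reduced u -> reduced v -> wperm u = wperm v ->
  hw u = hw v.
Proof.
move=> ru rv uv; apply/hecke_wordP; apply: matsumoto => //; exact: hecke_braid.
Qed.

(** As for [cox_reduced], except that at a descent the repeated letter is absorbed by idempotence,
    so the current word is kept. *)
Lemma hecke_reduced u :
  exists v, [/\ reduced v, {subset v <= u} & hw v = hw u].
Proof.
elim/last_ind: u => [|u i [v [rv vu vE]]].
  by exists [::]; split=> //; rewrite /reduced inv_id.
have [lt|] := boolP (wperm v i < wperm v i.+1).
  exists (rcons v i); split; first by rewrite reduced_rcons rv lt.
    by move=> x; rewrite !mem_rcons !inE => /orP[->//|/vu ->]; rewrite orbT.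
  by rewrite !hecke_word_rcons vE.
rewrite -wperm_descent => /(reduced_exchange rv) [v' [rv' v'v _ [rv'i v'iE]]].
exists v; split=> //; first by move=> x /vu; rewrite mem_rcons inE orbC => ->.
have := hecke_reduced_eq rv rv'i (esym v'iE).
rewrite hecke_word_rcons => vi.
by rewrite hecke_word_rcons -vE vi -mulgA hecke_gen2.
Qed.

Lemma cox_word_wperm u v : cw u = cw v -> wperm u = wperm v.
Proof.
move/cox_wordP; apply: (@pres_eq_ind_cong _ _ (fun u v => wperm u = wperm v)) => //.
- move=> {}u {}v [i j]; have [->|ij] := eqVneq i j.
    by rewrite cox_m_diag; apply: funext => x /=; rewrite transpK.
  rewrite /=; case: (cox_AP ij) => [far|near] /=; apply: funext => x /=.
    case/orP: far => ij'; first by rewrite (strans_comm _ ij') !transpK.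
    by rewrite -(strans_comm _ ij') !transpK.
  case/orP: near => /eqP <-.
    by rewrite strans_braid !transpK.
  by rewrite -(strans_braid j) !transpK.
- by move=> ? ? ? -> ->.
- by move=> a a' b b'; rewrite !wperm_cat => -> ->.
Qed.

(** [inv] bounds the size of every word from below, and a reduced word attains the bound. *)
Lemma cox_lengthE u : cox_length (cw u) = inv n (wperm u).
Proof.
rewrite /cox_length; case: ex_minnP => l /asboolP[v vE <-] l_min.
rewrite -(cox_word_wperm vE); apply/eqP; rewrite eqn_leq inv_wperm_le andbT.
have [v' [rv' _ v'E]] := cox_reduced v.
apply: (leq_trans (l_min (size v') _)).
  by apply/asboolP; exists v'; rewrite // v'E.
by rewrite -(eqP rv') (cox_word_wperm v'E).
Qed.

Lemma reduced_wordP w u : reduced_word w u <-> cw u = w /\ reduced u.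
Proof.
rewrite /reduced_word /reduced; split=> -[<-].
  by rewrite cox_lengthE => ->.
by rewrite cox_lengthE => /eqP ->.
Qed.

(** By Matsumoto's theorem the reduced word picked by [xget] does not matter, and its default does
    not occur because [u] is itself a candidate. *)
Lemma hecke_of_cox_word u : reduced u -> hecke_of_cox (cw u) = hw u.
Proof.
move=> ru; rewrite /hecke_of_cox; case: classical_sets.xgetP => [v _|/(_ u)].
  by move/reduced_wordP => [/cox_word_wperm vE rv]; apply: hecke_reduced_eq.
by case; apply/reduced_wordP.
Qed.

(** The two sides of every Hecke relation contain the same letters, so the support can be read off
    any word. *)
Lemma hecke_word_mem u v : hw u = hw v -> u =i v.
Proof.
move/hecke_wordP; apply: (@pres_eq_ind_cong _ _ (fun u v => u =i v)) => //.
- move=> {}u {}v [i x|i j ij x]; first by rewrite !inE orbb.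
  by rewrite /=; case: (cox_AP ij) => _ /=; rewrite !inE; do !case: eqP.
- by move=> a b ab x; rewrite ab.
- by move=> a b c ab bc x; rewrite ab bc.
- by move=> a a' b b' aa' bb' x; rewrite !mem_cat aa' bb'.
Qed.

Lemma hecke_word_rev u v : hw u = hw v -> hw (rev u) = hw (rev v).
Proof.
move/hecke_wordP => uv; apply/hecke_wordP; move: u v uv.
apply: (@pres_eq_ind_cong _ _ (fun u v => pres_eq _ (rev u) (rev v))).
- move=> u v [i|i j ij]; first by apply/pres_rel/Hecke_idem.
  have := hecke_braid ij; rewrite /=; case: (cox_AP ij) => _ //=.
  by rewrite /rev /=; apply: pres_sym.
- by move=> u; exact: pres_refl.
- by move=> u v; exact: pres_sym.
- by move=> u v w; exact: pres_trans.
- by move=> u u' v v' uu' vv'; rewrite !rev_cat; apply: pres_cat.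
Qed.

Lemma supp_word u : supp (hw u) = [set i in u]%SET.
Proof.
apply/setP => i; rewrite !inE; apply/asboolP/idP => [[w [v [wE]]]|iu].
  case/reduced_wordP => vw rv iv; rewrite -vw hecke_of_cox_word // in wE.
  by rewrite -(hecke_word_mem wE).
have [v [rv vu vE]] := hecke_reduced u.
exists (cw v), v; split; first by rewrite hecke_of_cox_word.
  exact/reduced_wordP.
by rewrite (hecke_word_mem vE).
Qed.

(** A right action, the first letter acting first: multiplying on the right by a generator sorts the
    result once more. *)
Definition act u f : nat -> nat := foldl (fun f i => bubble i f) f u.

Lemma act_cat u v f : act (u ++ v) f = act v (act u f).
Proof. exact: foldl_cat. Qed.

Lemma act_rcons u i f : act (rcons u i) f = bubble i (act u f).
Proof. by rewrite -cats1 act_cat. Qed.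

Lemma act_hecke u v f : hw u = hw v -> act u f = act v f.
Proof.
move/hecke_wordP => uv; move: u v uv f.
apply: (@pres_eq_ind_cong _ _ (fun u v => forall f, act u f = act v f)) => //.
- move=> u v [i|i j ij] f; first by rewrite /= bubble_idem.
  rewrite /=; case: (cox_AP ij) => /= /orP[] ij'.
  + by rewrite (bubble_comm _ ij').
  + by rewrite -(bubble_comm _ ij').
  + by rewrite -(eqP ij') -bubble_braid.
  + by rewrite -(eqP ij') bubble_braid.
- by move=> u v w uv vw f; rewrite uv vw.
- by move=> u u' v v' uu' vv' f; rewrite !act_cat uu' vv'.
Qed.

Lemma act_reduced u : reduced u -> act u id = wperm u.
Proof.
elim/last_ind: u => [|u i IHu] //; rewrite reduced_rcons => /andP[ru ui].
by rewrite act_rcons wperm_rcons IHu // bubble_ascent.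
Qed.

(** A reduced word acts on [id] by producing its permutation, and the permutation determines the
    element by Matsumoto's theorem. *)
Lemma hecke_faithful u v : act u id = act v id -> hw u = hw v.
Proof.
have [u' [ru' _ u'E]] := hecke_reduced u.
have [v' [rv' _ v'E]] := hecke_reduced v.
rewrite -(act_hecke _ u'E) -(act_hecke _ v'E) !act_reduced // => uv.
by rewrite -u'E -v'E; apply: hecke_reduced_eq.
Qed.

Lemma act_comp (g f : nat -> nat) u : {homo g : x y / x <= y} ->
  act u (g \o f) = g \o act u f.
Proof.
move=> g_mono; elim/last_ind: u => // u i IHu.
by rewrite !act_rcons IHu bubble_comp.
Qed.

Lemma inv_bubble f i : inv n f <= inv n (bubble i f) ?= iff (f i.+1 <= f i).
Proof.
have [le|lt] := leqP (f i.+1) (f i).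
  by split; rewrite bubble_descent ?eqxx.
by rewrite bubble_ascent //; split; rewrite inv_ascent //; lia.
Qed.

Lemma inv_act u f : inv n f <= inv n (act u f).
Proof.
elim/last_ind: u => // u i IHu.
by rewrite act_rcons (leq_trans IHu) // inv_bubble.
Qed.

(** [inv] never decreases under a sorting step and is constant only where the values already
    descend. If [f] comes back to itself, no step on the way can have changed it. *)
Lemma act_fixed u f : act u f = f -> forall i, i \in u -> f i.+1 <= f i.
Proof.
elim: u => // j u IHu; rewrite [act _ _]/= -/(act u _) => uf.
have fj : f j.+1 <= f j.
  rewrite -(geq_leqif (inv_bubble f j)).
  by rewrite -{2}uf inv_act.
move=> i; rewrite inE => /orP[/eqP -> //|]; apply: IHu.
by rewrite bubble_descent in uf.
Qed.

Lemma hecke_descent u i :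
  (hw u * hs i = hw u)%g <-> act u id i.+1 <= act u id i.
Proof.
rewrite -hecke_word_rcons; split=> [/(act_hecke id)|ui].
  by rewrite act_rcons => /(@act_fixed [:: i]); apply; rewrite inE.
by apply: hecke_faithful; rewrite act_rcons bubble_descent.
Qed.

(* The 0-1 principle of sorting networks. *)
Lemma hecke_descent01 u i :
    (forall f, (forall p, f p <= 1) -> act u f i.+1 <= act u f i) ->
  (hw u * hs i = hw u)%g.
Proof.
move=> sorted01; apply/hecke_descent; rewrite leqNgt; apply/negP => lt.
(* Thresholding at the larger of the two offending values turns the ascent into one of a 0-1
   function. *)
pose g x : nat := act u id i.+1 <= x.
have g_mono : {homo g : x y / x <= y} by rewrite /g => x y; lia.
have := sorted01 (g \o id) (fun p => leq_b1 _).
by rewrite (act_comp _ _ g_mono) /= /g leqnn leqNgt ltnS leqn0 eqb0 -ltnNge lt.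
Qed.

Lemma act01 u f : (forall p, f p <= 1) -> forall p, act u f p <= 1.
Proof.
move=> f01 p; have -> : f = minn 1 \o f.
  by apply: funext => q /=; have := f01 q; lia.
by rewrite act_comp /= ?geq_minl // => x y; lia.
Qed.

(* This characterizes w_0^J in the Hecke monoid, see hecke_w0_top and
   hecke_top_uniq. *)
Definition hecke_top J h : Prop :=
  (exists2 u, h = hw u & {subset u <= J}) /\
  (forall j, j \in J -> (h * hs j = h)%g).

Lemma hecke_top_mulr J h u : hecke_top J h -> {subset u <= J} ->
  (h * hw u = h)%g.
Proof.
case=> _ absorb; elim/last_ind: u => [|u i IHu] uJ; first by rewrite mulg1.
rewrite hecke_word_rcons mulgA IHu ?absorb // => [|x xu]; apply: uJ.
  by rewrite mem_rcons inE eqxx.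
by rewrite mem_rcons inE xu orbT.
Qed.

(* Reversal of words turns right absorption into left absorption, and an
   element absorbing on the left equals one absorbing on the right. *)
Lemma hecke_top_mull J h u : hecke_top J h -> {subset u <= J} ->
  (hw u * h = h)%g.
Proof.
move=> hJ; have [[v hv vJ] _] := hJ.
have subrev s : {subset s <= J} -> {subset rev s <= J}.
  by move=> sJ x; rewrite mem_rev; apply: sJ.
have revJ s : {subset s <= J} -> (hw s * hw (rev v) = hw (rev v))%g.
  move=> sJ; have := hecke_top_mulr hJ (subrev _ sJ).
  by rewrite hv -!hecke_word_cat => /hecke_word_rev; rewrite rev_cat revK.
have -> : h = hw (rev v); first by rewrite -(hecke_top_mulr hJ (subrev _ vJ)) hv revJ.
exact: revJ.
Qed.

(** Right absorption by [h] and left absorption by [g] give h = h g = g. *)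
Lemma hecke_top_uniq J h g : hecke_top J h -> hecke_top J g -> h = g.
Proof.
move=> hJ gJ; have [[u hu uJ] _] := hJ; have [[v gv vJ] _] := gJ.
by rewrite -(hecke_top_mulr hJ vJ) -gv hu (hecke_top_mull gJ uJ).
Qed.

Lemma parabolicP J w :
  parabolic J w <-> exists2 u, w = cw u & {subset u <= J}.
Proof.
split=> [|[u -> {w}]].
  elim=> {w} [j jJ||_ _ _ [u -> uJ] _ [v -> vJ]|_ _ [u -> uJ]].
  - by exists [:: j] => // x; rewrite inE => /eqP ->.
  - by exists [::].
  - exists (u ++ v); first by rewrite cox_word_cat.
    by move=> x; rewrite mem_cat => /orP[/uJ|/vJ].
  - exists (rev u); last by move=> x; rewrite mem_rev => /uJ.
    apply: (@mulIg W (cw u)); rewrite mulVg -cox_word_cat.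
    by apply/esym/cox_wordP/cox_eq_rev_cat.
elim/last_ind: u => [_|u i IHu uJ]; first exact: Parabolic_1.
rewrite cox_word_rcons; apply: Parabolic_mul.
  by apply: IHu => x xu; apply: uJ; rewrite mem_rcons inE xu orbT.
by apply: Parabolic_gen; apply: uJ; rewrite mem_rcons inE eqxx.
Qed.

Lemma inv_le f : inv n f <= n.+1 * n.+1.
Proof.
have cst c : n.+1 * c = \sum_(p < n.+1) c by rewrite sum_nat_const card_ord.
rewrite cst; apply: leq_sum => p _; rewrite -[leqRHS]muln1 cst.
by apply: leq_sum => q _; exact: leq_b1.
Qed.

(** Lengths are inversion numbers, hence bounded, so a longest element exists and [w0] never takes
    its default value. *)
Lemma w0P J : is_longest J (w0 (cox_A n) J).
Proof.
rewrite /w0; case: classical_sets.xgetP => [w _ //|no_max].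
pose P l := `[< exists2 w, parabolic J w & @cox_length _ (cox_A n) w = l >].
have exP : exists l, P l.
  by exists (cox_length (1%g : W)); apply/asboolP; exists 1%g => //; exact: Parabolic_1.
have boundP l : P l -> l <= n.+1 * n.+1.
  move/asboolP => [w _ <-]; rewrite -(pclass_repr w).
  by rewrite -[pclass _ _]/(cw _) cox_lengthE inv_le.
case: (ex_maxnP exP boundP) => l /asboolP[w wJ wl] l_max.
case: (no_max w); split=> // v vJ; rewrite wl; apply: l_max.
by apply/asboolP; exists v.
Qed.

(** A letter of [J] that was not absorbed would be an ascent, and appending it would produce a
    longer element of the parabolic subgroup. *)
Lemma hecke_w0_top J : hecke_top J (hecke_of_cox (w0 (cox_A n) J)).
Proof.
have [/parabolicP[u0 wu0 u0J] w_max] := w0P J.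
have [u [ru uu0 uE]] := cox_reduced u0.
have uJ : {subset u <= J} by move=> x /uu0 /u0J.
move: w_max; rewrite wu0 -uE hecke_of_cox_word // => w_max.
split=> [|j jJ]; first by exists u.
apply/hecke_descent; rewrite leqNgt; apply/negP; rewrite act_reduced // => lt.
have := w_max (cw (rcons u j)); rewrite !cox_lengthE wperm_rcons inv_ascent //.
rewrite ltnn => abs; suff: false by []; apply/abs/parabolicP.
exists (rcons u j) => // x.
by rewrite mem_rcons inE => /orP[/eqP ->|/uJ].
Qed.

(** Idempotence says that a word [u] of [h] fixes [act u id]; by [act_fixed] every letter of [u] is
    then a descent, hence absorbed. *)
Lemma hecke_idem_top h : (h * h = h)%g -> hecke_top (supp h) h.
Proof.
rewrite -(hecke_word_repr h); move: (repr h) => u hh; rewrite supp_word; split.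
  by exists u => // i; rewrite inE.
move=> i; rewrite inE => iu; apply/hecke_descent.
apply: (act_fixed (u := u)) => //; rewrite -act_cat; apply: act_hecke.
by rewrite hecke_word_cat.
Qed.

Lemma hecke_top_supp J h : hecke_top J h -> supp h = J.
Proof.
case=> -[u -> uJ] absorb; rewrite supp_word; apply/setP => i; rewrite inE.
apply/idP/idP => [/uJ //|/absorb]; rewrite -hecke_word_rcons => /hecke_word_mem <-.
by rewrite mem_rcons inE eqxx.
Qed.

Lemma hecke_top_idem J h : hecke_top J h -> (h * h = h)%g.
Proof. by move=> hJ; have [[u hu uJ] _] := hJ; rewrite {2}hu (hecke_top_mulr hJ). Qed.

Lemma hecke_top_subset J1 J2 h1 h2 : hecke_top J1 h1 -> hecke_top J2 h2 ->
  J1 \subset J2 -> (h1 * h2 = h2)%g.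
Proof.
move=> [[u -> uJ1] _] h2J /subsetP J12.
by apply: (hecke_top_mull h2J) => x /uJ1 /J12.
Qed.

End TypeA.

(** * Sorting overlapping blocks *)

Section BlockSums.
Implicit Types (f : nat -> nat) (a b c p q : nat).

Lemma sum_nat_ge f a b c : (forall p, a <= p < b -> c <= f p) ->
  c * (b - a) <= \sum_(a <= p < b) f p.
Proof.
move=> cf; rewrite mulnC -sum_nat_const_nat big_nat [leqRHS]big_nat.
exact: leq_sum.
Qed.

Lemma sum_nat_le f a b c : (forall p, a <= p < b -> f p <= c) ->
  \sum_(a <= p < b) f p <= c * (b - a).
Proof.
move=> cf; rewrite mulnC -sum_nat_const_nat big_nat [leqRHS]big_nat.
exact: leq_sum.
Qed.

Lemma sum_nat_at f a b p : a <= p < b -> \sum_(a <= q < b) f q =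
  \sum_(a <= q < p) f q + f p + \sum_(p.+1 <= q < b) f q.
Proof.
case/andP=> ap pb; rewrite (big_cat_nat (n := p)) //=; last exact: ltnW.
by rewrite (big_ltn pb) addnA.
Qed.

Lemma sum_nat_zero f a b p : (forall q, f q <= 1) -> a <= p < b -> f p = 0 ->
  \sum_(a <= q < b) f q < b - a.
Proof.
move=> f1 pab fp; rewrite (sum_nat_at f pab) fp addn0.
have := @sum_nat_le f a p 1 (fun q _ => f1 q).
have := @sum_nat_le f p.+1 b 1 (fun q _ => f1 q).
by lia.
Qed.

Lemma sum_nat_pos f a b p : a <= p < b -> 0 < f p -> 0 < \sum_(a <= q < b) f q.
Proof. by move=> pab; rewrite (sum_nat_at f pab); lia. Qed.

Lemma sum_nat_lt_ex f a b : \sum_(a <= q < b) f q < b - a ->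
  exists2 p, a <= p < b & f p = 0.
Proof.
move=> lt; suff /hasP[p] : has (fun p => f p == 0) (index_iota a b).
  by rewrite mem_index_iota => pab /eqP; exists p.
apply/negPn/negP => /hasPn no0; have := @sum_nat_ge f a b 1; rewrite mul1n.
have H p : a <= p < b -> 0 < f p.
  by move=> pab; rewrite lt0n; apply: no0; rewrite mem_index_iota.
by move/(_ H); rewrite leqNgt lt.
Qed.

Lemma sum_nat_gt0_ex f a b : 0 < \sum_(a <= q < b) f q ->
  exists2 p, a <= p < b & 0 < f p.
Proof.
move=> gt; suff /hasP[p] : has (fun p => 0 < f p) (index_iota a b).
  by rewrite mem_index_iota => pab ?; exists p.
apply/negPn/negP => /hasPn no; have := @sum_nat_le f a b 0; rewrite mul0n.
have H p : a <= p < b -> f p <= 0.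
  by move=> pab; rewrite leqNgt; apply: no; rewrite mem_index_iota.
by move/(_ H); rewrite leqNgt gt.
Qed.

Definition descends a b f := forall p, a <= p -> p.+1 < b -> f p.+1 <= f p.

Lemma descends_le a b f p q : descends a b f -> a <= p -> p <= q -> q < b ->
  f q <= f p.
Proof.
move=> fd ap; elim: q => [|q IHq] pq qb; first by rewrite (_ : p = 0) //; lia.
have [->//|pq'] := eqVneq p q.+1.
by apply: leq_trans (IHq _ _); first (apply: fd; lia); lia.
Qed.

End BlockSums.

(* Properties of the action of w_0^J when J generates the permutations of the
   block of positions [x, y). *)
Record sorts (x y : nat) (F : (nat -> nat) -> nat -> nat) : Prop := Sorts {
  sorts_out : forall f p, ~~ (x <= p < y) -> F f p = f p;
  sorts_sum : forall f, \sum_(x <= p < y) F f p = \sum_(x <= p < y) f p;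
  sorts_desc : forall f, descends x y (F f);
  sorts_le1 : forall f, (forall p, f p <= 1) -> forall p, F f p <= 1 }.

(* Three consecutive blocks A = [x, y), B = [y, z), C = [z, w), where F sorts
   A B and G sorts B C. *)
Section ThreeBlocks.
Variables (x y z w : nat) (F G : (nat -> nat) -> nat -> nat).
Hypotheses (xy : x < y) (yz : y < z) (zw : z < w).
Hypotheses (sF : sorts x z F) (sG : sorts y w G).
Implicit Type f : nat -> nat.

Let total f := \sum_(x <= p < w) f p.

Let split_z f : total f = \sum_(x <= p < z) f p + \sum_(z <= p < w) f p.
Proof. by rewrite /total (big_cat_nat (n := z)) //=; lia. Qed.

Let split_y f : total f = \sum_(x <= p < y) f p + \sum_(y <= p < w) f p.
Proof. by rewrite /total (big_cat_nat (n := y)) //=; lia. Qed.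

Let split_l f : \sum_(x <= p < z) f p = \sum_(x <= p < y) f p + \sum_(y <= p < z) f p.
Proof. by rewrite (big_cat_nat (n := y)) //=; lia. Qed.

Let split_r f : \sum_(y <= p < w) f p = \sum_(y <= p < z) f p + \sum_(z <= p < w) f p.
Proof. by rewrite (big_cat_nat (n := z)) //=; lia. Qed.

Let F_right f p : z <= p -> F f p = f p.
Proof. by move=> zp; rewrite (sorts_out sF) //; lia. Qed.

Let G_left f p : p < y -> G f p = f p.
Proof. by move=> zp; rewrite (sorts_out sG) //; lia. Qed.

Let F_right_sum f : \sum_(z <= p < w) F f p = \sum_(z <= p < w) f p.
Proof.
by rewrite big_nat [RHS]big_nat; apply: eq_bigr => p /andP[? _]; rewrite F_right.
Qed.

Let G_left_sum f : \sum_(x <= p < y) G f p = \sum_(x <= p < y) f p.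
Proof.
by rewrite big_nat [RHS]big_nat; apply: eq_bigr => p /andP[_ ?]; rewrite G_left.
Qed.

Let total_F f : total (F f) = total f.
Proof. by rewrite !split_z (sorts_sum sF) F_right_sum. Qed.

Let total_G f : total (G f) = total f.
Proof. by rewrite !split_y (sorts_sum sG) G_left_sum. Qed.

Let desc_glue f : descends x z f -> descends y w f -> descends x w f.
Proof.
by move=> d1 d2 p xp pw; have [pz|zp] := ltnP p.+1 z; [exact: d1|apply: d2; lia].
Qed.

(** The only possible failure is a 0 at z-1 followed by a 1 at z. Then [f2] is 1 on all of B, so its
    zero in A B lies in A, where [G] does nothing; hence [f1] vanishes on B. The ones of [f2] on B
    C, more than |B| of them, would all come from C, which has at most |B| positions. *)
Lemma sorts_FGF f : w - z <= z - y -> (forall p, f p <= 1) ->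
  descends x w (F (G (F f))).
Proof.
move=> cb f01; set f1 := F f; set f2 := G f1; set f3 := F f2.
have f1le := sorts_le1 sF f01 : forall p, f1 p <= 1.
have f2le := sorts_le1 sG f1le : forall p, f2 p <= 1.
have f3le := sorts_le1 sF f2le : forall p, f3 p <= 1.
have d1 : descends x z f1 by exact: (sorts_desc sF).
have d2 : descends y w f2 by exact: (sorts_desc sG).
have d3 : descends x z f3 by exact: (sorts_desc sF).
move=> p xp pw; have [pz|] := ltnP p.+1 z; first exact: d3.
rewrite leq_eqVlt => /orP[/eqP zp|zp]; last first.
  by rewrite /f3 !F_right; [apply: d2; lia|lia|lia].
rewrite leqNgt; apply/negP => lt.
have f3p : f3 p = 0 by have := f3le p.+1; lia.
have f2z : 0 < f2 z by rewrite -(F_right f2) // zp -/f3; lia.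
have : \sum_(x <= q < z) f2 q < z - x.
  by rewrite -(sorts_sum sF); apply: (sum_nat_zero (p := p)) => //; lia.
case/sum_nat_lt_ex => q qxz f2q.
have qy : q < y.
  rewrite ltnNge; apply/negP => yq.
  by have := @descends_le y w f2 q z d2 yq; lia.
have f1q : f1 q = 0 by rewrite -f2q /f2 G_left.
have := sorts_sum sG f1; rewrite -/f2 !split_r.
have : \sum_(y <= r < z) f1 r <= 0 * (z - y).
  apply: sum_nat_le => r ryz.
  by have := @descends_le x z f1 q r d1; lia.
have : 1 * (z - y) <= \sum_(y <= r < z) f2 r.
  apply: sum_nat_ge => r ryz.
  by have := @descends_le y w f2 r z d2; lia.
have : \sum_(z <= r < w) f1 r <= 1 * (w - z) by apply: sum_nat_le.
have : 0 < \sum_(z <= r < w) f2 r by apply: (sum_nat_pos (p := z)) => //; lia.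
by lia.
Qed.

(** Dual to [sorts_FGF], counting zeros: a failure at the boundary of A and B would require more
    than |B| zeros of [f1] inside A. *)
Lemma sorts_GFG f : y - x <= z - y -> (forall p, f p <= 1) ->
  descends x w (G (F (G f))).
Proof.
move=> ab f01; set f1 := G f; set f2 := F f1; set f3 := G f2.
have f1le := sorts_le1 sG f01 : forall p, f1 p <= 1.
have f2le := sorts_le1 sF f1le : forall p, f2 p <= 1.
have f3le := sorts_le1 sG f2le : forall p, f3 p <= 1.
have d1 : descends y w f1 by exact: (sorts_desc sG).
have d2 : descends x z f2 by exact: (sorts_desc sF).
have d3 : descends y w f3 by exact: (sorts_desc sG).
move=> p xp pw; have [yp|py] := leqP y p; first exact: d3.
have [py1|yp1] := ltnP p.+1 y.
  by rewrite /f3 !G_left //; apply: d2; lia.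
rewrite leqNgt; apply/negP => lt.
have f2p : f2 p = 0 by rewrite -(G_left f2) // -/f3; have := f3le p.+1; lia.
have : 0 < \sum_(y <= q < w) f2 q.
  by rewrite -(sorts_sum sG) -/f3; apply: (sum_nat_pos (p := p.+1)); lia.
case/sum_nat_gt0_ex => q qyw f2q.
have zq : z <= q.
  rewrite leqNgt; apply/negP => qz.
  by have := @descends_le x z f2 p q d2; lia.
have f1q : 0 < f1 q by rewrite -(F_right f1).
have := sorts_sum sF f1; rewrite -/f2 !split_l.
have : 1 * (z - y) <= \sum_(y <= r < z) f1 r.
  apply: sum_nat_ge => r ryz.
  by have := @descends_le y w f1 r q d1; lia.
have : \sum_(y <= r < z) f2 r <= 0 * (z - y).
  apply: sum_nat_le => r ryz.
  by have := @descends_le x z f2 p r d2; lia.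
have : \sum_(x <= r < y) f2 r < y - x by apply: (sum_nat_zero (p := p)) => //; lia.
by lia.
Qed.

(* A single one, placed at the end of C, cannot reach A. *)
Lemma not_sorts_FG :
  ~ (forall f, (forall p, f p <= 1) -> descends x w (G (F f))).
Proof.
pose f p : nat := p == w.-1.
move=> /(_ f (fun p => leq_b1 _)) d.
have tf : 0 < total f by apply: (sum_nat_pos (p := w.-1)); rewrite /f ?eqxx //; lia.
have : \sum_(x <= p < z) f p <= 0 * (z - x) by apply: sum_nat_le => p; rewrite /f; lia.
rewrite -(sorts_sum sF) mul0n leqn0 => sF0.
have h0 : G (F f) x = 0.
  rewrite G_left //; apply/eqP; rewrite -leqn0 leqNgt; apply/negP => pos.
  have : x <= x < z by lia.
  by move/(sum_nat_pos)/(_ pos); rewrite (eqP sF0).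
move: tf; rewrite -total_F -total_G => /sum_nat_gt0_ex[p pxw].
by have := @descends_le x w _ x p d; lia.
Qed.

(* A single zero, placed at the start of A, cannot reach C. *)
Lemma not_sorts_GF :
  ~ (forall f, (forall p, f p <= 1) -> descends x w (F (G f))).
Proof.
pose f p : nat := p != x.
have f01 p : f p <= 1 by exact: leq_b1.
move=> /(_ f f01) d.
have tf : total f < w - x by apply: (sum_nat_zero (p := x)); rewrite /f ?eqxx //; lia.
have : 1 * (w - y) <= \sum_(y <= p < w) f p by apply: sum_nat_ge => p; rewrite /f; lia.
rewrite -(sorts_sum sG) mul1n => sG1.
have h1 : 0 < F (G f) w.-1.
  rewrite F_right; last by lia.
  rewrite lt0n; apply/eqP => g0; move: sG1; rewrite leqNgt => /negP; apply.
  by apply: (sum_nat_zero (p := w.-1)) => //; [exact: (sorts_le1 sG)|lia].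
move: tf; rewrite -total_G -total_F => /sum_nat_lt_ex[p pxw].
by have := @descends_le x w _ p w.-1 d; lia.
Qed.

(** Either side of the braid relation ends with [F] or with [G], so their common value descends on A
    B and on B C, hence everywhere since B separates A from C. Counting ones on suitable functions
    then bounds |C| and |A| by |B|. *)
Lemma braid_sorts : (forall f, F (G (F f)) = G (F (G f))) ->
  (w - z <= z - y) /\ (y - x <= z - y).
Proof.
move=> braid; have desc f : descends x w (F (G (F f))).
  apply: desc_glue; first exact: (sorts_desc sF).
  by rewrite braid; exact: (sorts_desc sG).
(* Witnesses: ones exactly on C if |C| > |B|, ones exactly on B C if |A| > |B|. *)
split; rewrite leqNgt; apply/negP => lt.
  pose f p : nat := z <= p < w.
  have f01 p : f p <= 1 by exact: leq_b1.
  set f1 := F f; set f2 := G f1; set h := F f2.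
  have d : descends x w h by exact: desc.
  have fl : \sum_(x <= p < z) f p <= 0 * (z - x).
    by apply: sum_nat_le => p; rewrite /f; lia.
  have fr : \sum_(z <= p < w) f p <= 1 * (w - z).
    by apply: sum_nat_le => p _; exact: leq_b1.
  have fr' : 1 * (w - z) <= \sum_(z <= p < w) f p.
    by apply: sum_nat_ge => p; rewrite /f; lia.
  have f2m : \sum_(y <= p < z) f2 p <= 1 * (z - y).
    by apply: sum_nat_le => p _; apply: (sorts_le1 sG); exact: (sorts_le1 sF).
  (* At most |B| of the |C| ones fit into B, so at least |C| - |B| stay in C. As [h] descends, A B
     is then full of ones, and the total is at least |A| + |C| instead of |C|. *)
  have := sorts_sum sG f1; rewrite -/f2 !split_r (F_right_sum f) => f2s.
  have f2r : 0 < \sum_(z <= p < w) f2 p by lia.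
  have := f2r; rewrite -F_right_sum -/h => /sum_nat_gt0_ex[p pzw hp].
  have hl : 1 * (z - x) <= \sum_(x <= q < z) h q.
    by apply: sum_nat_ge => q qxz; have := @descends_le x w h q p d; lia.
  have : total h = total f by rewrite /h total_F /f2 total_G /f1 total_F.
  rewrite (split_z f) (split_z h) F_right_sum.
  by lia.
pose f p : nat := y <= p < w.
have f01 p : f p <= 1 by exact: leq_b1.
have := desc f; rewrite braid; set f1 := G f; set f2 := F f1; set h := G f2 => d.
have fl : \sum_(x <= p < y) f p <= 0 * (y - x).
  by apply: sum_nat_le => p; rewrite /f; lia.
have fr : 1 * (w - y) <= \sum_(y <= p < w) f p.
  by apply: sum_nat_ge => p; rewrite /f; lia.
have f1m : \sum_(y <= p < z) f1 p <= 1 * (z - y).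
  by apply: sum_nat_le => p _; exact: (sorts_le1 sG).
(* A B receives at most |B| ones, fewer than |A|, so a zero stays in A. As [h] descends, no one is
   left in B C, and the total is at most |B| instead of |B| + |C|. *)
have := sorts_sum sF f1; rewrite -/f2 !split_l (G_left_sum f) => f2s.
have f2l : \sum_(x <= p < y) f2 p < y - x by lia.
have := f2l; rewrite -G_left_sum -/h => /sum_nat_lt_ex[p pxy hp].
have hr : \sum_(y <= q < w) h q <= 0 * (w - y).
  by apply: sum_nat_le => q qyw; have := @descends_le x w h p q d; lia.
have : total h = total f by rewrite /h total_G /f2 total_F /f1 total_G.
rewrite (split_y f) (split_y h) G_left_sum.
by lia.
Qed.

End ThreeBlocks.

(** * Longest elements of intervals as block sorts *)

Section BlockTops.
Variable n : nat.
Local Notation H := (hecke (cox_A n)).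
Local Notation hw := (@hecke_word 'I_n (cox_A n)).
Local Notation hs := (@hecke_gen 'I_n (cox_A n)).
Implicit Types (h g : H) (f : nat -> nat).

(* The letters i such that the positions i and i.+1 both lie in [x, y). *)
Definition block (x y : nat) : {set 'I_n} := [set j : 'I_n | x <= j & j.+1 < y].

Definition hact h := act (repr h).

Lemma hact_word u : hact (hw u) = act u.
Proof. by apply: funext => f; apply: act_hecke; rewrite hecke_word_repr. Qed.

Lemma hactM h g f : hact (h * g)%g f = hact g (hact h f).
Proof.
rewrite -(hecke_word_repr h) -(hecke_word_repr g) -hecke_word_cat !hact_word.
exact: act_cat.
Qed.

Lemma hact_desc h (i : 'I_n) f : (h * hs i = h)%g -> hact h f i.+1 <= hact h f i.
Proof.
move=> hi; apply: (@act_fixed _ [:: i]); last by rewrite inE.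
by rewrite -hact_word -[X in hact X]/(hs i) -hactM hi.
Qed.

Lemma hact_desc01 h (i : 'I_n) :
  (forall f, (forall p, f p <= 1) -> hact h f i.+1 <= hact h f i) ->
  (h * hs i = h)%g.
Proof. by rewrite -{3 4}(hecke_word_repr h); exact: hecke_descent01. Qed.

Lemma sum_bubble (i x y : nat) f : x <= i -> i.+1 < y ->
  \sum_(x <= p < y) bubble i f p = \sum_(x <= p < y) f p.
Proof.
move=> xi iy; have ixy : x <= i < y by lia.
have sp (g : nat -> nat) : \sum_(x <= p < y) g p =
    \sum_(x <= p < i) g p + (g i + g i.+1) + \sum_(i.+2 <= p < y) g p.
  rewrite (sum_nat_at g ixy) (big_ltn iy) addnA; congr (_ + _).
  by rewrite addnA.
rewrite !sp bubble_l bubble_r; congr (_ + _ + _).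
- by rewrite big_nat [RHS]big_nat; apply: eq_bigr => p ?; rewrite bubble_far //; lia.
- by lia.
- by rewrite big_nat [RHS]big_nat; apply: eq_bigr => p ?; rewrite bubble_far //; lia.
Qed.

(** The letters of a word of [h] act inside the block, which fixes the outside and preserves the
    sum; descent is absorption of the letters of the block. *)
Lemma block_top_sorts x y h : y <= n.+1 -> hecke_top (block x y) h ->
  sorts x y (hact h).
Proof.
move=> yn [[u hu uJ] absorb].
have {}uJ i : i \in u -> x <= i /\ i.+1 < y by move/uJ; rewrite inE => /andP[].
rewrite hu hact_word; split.
- move=> f p out; elim: u uJ f {hu} => //= i u IHu uJ f.
  rewrite IHu => [|j ju]; last by apply: uJ; rewrite inE ju orbT.
  by have [] := uJ i (mem_head _ _) => ? ?; rewrite bubble_far //; lia.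
- move=> f; elim: u uJ f {hu} => //= i u IHu uJ f.
  rewrite IHu => [|j ju]; last by apply: uJ; rewrite inE ju orbT.
  by have [] := uJ i (mem_head _ _) => ? ?; rewrite sum_bubble.
- move=> f p xp py; have pn : p < n by lia.
  rewrite -hact_word -hu; apply: (@hact_desc h (Ordinal pn) f).
  by apply: absorb; rewrite inE xp py.
- by move=> f; exact: act01.
Qed.

Section Overlap.
Variables (x y z w : nat) (h g : H).
Hypotheses (xy : x < y) (yz : y < z) (zw : z < w) (wn : w <= n.+1).
Hypotheses (hJ : hecke_top (block x z) h) (gJ : hecke_top (block y w) g).

Let sF : sorts x z (hact h).
Proof. by apply: block_top_sorts => //; lia. Qed.

Let sG : sorts y w (hact g).
Proof. exact: block_top_sorts. Qed.

Let words u v : {subset u <= block x z} -> {subset v <= block y w} ->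
  {subset u ++ v <= block x w} /\ {subset v ++ u <= block x w}.
Proof.
move=> uJ vJ; split=> i; rewrite mem_cat; last rewrite orbC.
  by case/orP => [/uJ|/vJ]; rewrite !inE; lia.
by case/orP => [/uJ|/vJ]; rewrite !inE; lia.
Qed.

Lemma block_top_hgh : w - z <= z - y -> hecke_top (block x w) (h * g * h)%g.
Proof.
move=> cb; split.
  have [[u hu uJ] _] := hJ; have [[v gv vJ] _] := gJ.
  exists ((u ++ v) ++ u); first by rewrite !hecke_word_cat -hu -gv.
  move=> i; rewrite mem_cat => /orP[|]; first exact: (words uJ vJ).1.
  by move/uJ; rewrite !inE; lia.
move=> i; rewrite inE => /andP[xi iw]; apply: hact_desc01 => f f01.
by rewrite !hactM; apply: (sorts_FGF xy yz zw sF sG).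
Qed.

Lemma block_top_ghg : y - x <= z - y -> hecke_top (block x w) (g * h * g)%g.
Proof.
move=> ab; split.
  have [[u hu uJ] _] := hJ; have [[v gv vJ] _] := gJ.
  exists ((v ++ u) ++ v); first by rewrite !hecke_word_cat -hu -gv.
  move=> i; rewrite mem_cat => /orP[|]; first exact: (words uJ vJ).2.
  by move/vJ; rewrite !inE; lia.
move=> i; rewrite inE => /andP[xi iw]; apply: hact_desc01 => f f01.
by rewrite !hactM; apply: (sorts_GFG xy yz zw sF sG).
Qed.

Let sorted_desc k f : (forall i, i \in block x w -> k * hs i = k)%g ->
  descends x w (hact k f).
Proof.
move=> absorb p xp pw; have pn : p < n by lia.
by apply: (@hact_desc k (Ordinal pn) f); apply: absorb; rewrite inE xp pw.
Qed.

Lemma hg_not_top : ~ (forall i, i \in block x w -> h * g * hs i = h * g)%g.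
Proof.
move=> absorb; apply: (not_sorts_FG xy yz zw sF sG) => f _.
by rewrite -hactM; exact: sorted_desc.
Qed.

Lemma gh_not_top : ~ (forall i, i \in block x w -> g * h * hs i = g * h)%g.
Proof.
move=> absorb; apply: (not_sorts_GF xy yz zw sF sG) => f _.
by rewrite -hactM; exact: sorted_desc.
Qed.

(** If they commuted, the product would absorb the letters of both blocks, hence those of their
    union, against [hg_not_top]. *)
Lemma blocks_not_comm : (h * g <> g * h)%g.
Proof.
move=> hg; apply: hg_not_top => i; rewrite inE => /andP[xi iw].
have [iz|zi] := ltnP i.+1 z.
  by rewrite hg -mulgA (proj2 hJ) // inE xi iz.
by rewrite -mulgA (proj2 gJ) // inE iw andbT; lia.
Qed.

Lemma blocks_braid : (h * g * h = g * h * g)%g ->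
  (w - z <= z - y) /\ (y - x <= z - y).
Proof.
move=> hgh; apply: (braid_sorts xy yz zw sF sG) => f.
by rewrite -!hactM !mulgA hgh.
Qed.

End Overlap.
End BlockTops.

(** * Homomorphisms given by blocks *)

Section LocalInjectivity.
Variables (G : monoidType) (p q : G).
Hypotheses (pp : (p * p = p)%g) (qq : (q * q = q)%g).
Local Open Scope group_scope.

(* The elements of the monoid generated by p and q are told apart by the
   generators they absorb on either side. *)
Let fixes x : bool * bool * bool * bool :=
  (`[< p * x = x >], `[< q * x = x >], `[< x * p = x >], `[< x * q = x >]).

Lemma commuting_pair_inj (G' : monoidType) (f : G' -> G) s t x y :
    p * q = q * p -> p <> p * q -> q <> p * q ->
    f 1 = 1 -> f s = p -> f t = q -> f (s * t) = p * q ->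
    x \in [:: 1; s; t; s * t] -> y \in [:: 1; s; t; s * t] ->
  f x = f y -> x = y.
Proof.
move=> comm np nq f1 fs ft fst.
have p1 : p <> 1 by move=> p1; apply: nq; rewrite p1 mul1g.
have q1 : q <> 1 by move=> q1; apply: np; rewrite q1 mulg1.
have q1p : q * p <> p by rewrite -comm => /esym.
have F1 : fixes 1 = (false, false, false, false).
  by rewrite /fixes !mulg1 !mul1g !asboolF.
have Fp : fixes p = (true, false, true, false).
  by rewrite /fixes !(asboolT pp) !asboolF // => /esym.
have Fq : fixes q = (false, true, false, true).
  by rewrite /fixes !(asboolT qq) -comm !asboolF // => /esym.
have Fpq : fixes (p * q) = (true, true, true, true).
  have e1 : p * (p * q) = p * q by rewrite mulgA pp.
  have e2 : q * (p * q) = p * q by rewrite comm mulgA qq.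
  have e3 : p * q * p = p * q by rewrite {1}comm -mulgA pp.
  have e4 : p * q * q = p * q by rewrite -mulgA qq.
  by rewrite /fixes !asboolT.
rewrite !inE => /or4P[] /eqP -> /or4P[] /eqP -> // /(congr1 fixes);
  by rewrite ?f1 ?fs ?ft ?fst ?F1 ?Fp ?Fq ?Fpq.
Qed.

(** Any coincidence between absorption patterns would collapse [p * q] or [q * p] onto [p * q * p],
    so the two assumed inequalities already separate all six elements. *)
Lemma braided_pair_inj (G' : monoidType) (f : G' -> G) s t x y :
    p * q * p = q * p * q -> p * q <> p * q * p -> q * p <> p * q * p ->
    f 1 = 1 -> f s = p -> f t = q -> f (s * t) = p * q -> f (t * s) = q * p ->
    f (s * t * s) = p * q * p ->
    x \in [:: 1; s; t; s * t; t * s; s * t * s] ->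
    y \in [:: 1; s; t; s * t; t * s; s * t * s] ->
  f x = f y -> x = y.
Proof.
move=> braid npq nqp f1 fs ft fst fts fsts.
have p1 : p <> 1 by move=> e; apply: npq; rewrite e !mul1g mulg1.
have q1 : q <> 1 by move=> e; apply: npq; rewrite e !mulg1 pp.
have qp_p : q * p <> p.
  by move=> e; apply: npq; rewrite braid e.
have pq_p : p * q <> p.
  by move=> e; apply: nqp; rewrite braid -mulgA e.
have pq_q : p * q <> q by move=> e; apply: nqp; rewrite e.
have qp_q : q * p <> q by move=> e; apply: npq; rewrite -mulgA e.
have F1 : fixes 1 = (false, false, false, false).
  by rewrite /fixes !mulg1 !mul1g !asboolF.
have Fp : fixes p = (true, false, true, false).
  by rewrite /fixes !(asboolT pp) !asboolF.
have Fq : fixes q = (false, true, false, true).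
  by rewrite /fixes !(asboolT qq) !asboolF.
have Fpq : fixes (p * q) = (true, false, false, true).
  have e1 : p * (p * q) = p * q by rewrite mulgA pp.
  have e2 : q * (p * q) <> p * q by rewrite mulgA -braid => /esym.
  have e3 : p * q * p <> p * q by move/esym.
  have e4 : p * q * q = p * q by rewrite -mulgA qq.
  by rewrite /fixes (asboolT e1) (asboolT e4) (asboolF e2) (asboolF e3).
have Fqp : fixes (q * p) = (false, true, true, false).
  have e1 : p * (q * p) <> q * p by rewrite mulgA => /esym.
  have e2 : q * (q * p) = q * p by rewrite mulgA qq.
  have e3 : q * p * p = q * p by rewrite -mulgA pp.
  have e4 : q * p * q <> q * p by rewrite -braid => /esym.
  by rewrite /fixes (asboolT e2) (asboolT e3) (asboolF e1) (asboolF e4).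
have Fpqp : fixes (p * q * p) = (true, true, true, true).
  have e1 : p * (p * q * p) = p * q * p by rewrite !mulgA pp.
  have e2 : q * (p * q * p) = p * q * p by rewrite braid !mulgA qq.
  have e3 : p * q * p * p = p * q * p by rewrite -mulgA pp.
  have e4 : p * q * p * q = p * q * p by rewrite braid -mulgA qq.
  by rewrite /fixes !asboolT.
have mem6 z : z \in [:: 1; s; t; s * t; t * s; s * t * s] ->
    [\/ z = 1 /\ fixes (f z) = (false, false, false, false),
        z = s /\ fixes (f z) = (true, false, true, false),
        z = t /\ fixes (f z) = (false, true, false, true) |
        [\/ z = s * t /\ fixes (f z) = (true, false, false, true),
        z = t * s /\ fixes (f z) = (false, true, true, false) |
        z = s * t * s /\ fixes (f z) = (true, true, true, true)]].
  rewrite !inE => /or4P[/eqP->|/eqP->|/eqP->|].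
  - by constructor 1; rewrite f1 F1.
  - by constructor 2; rewrite fs Fp.
  - by constructor 3; rewrite ft Fq.
  case/or3P => /eqP ->; constructor 4.
  - by constructor 1; rewrite fst Fpq.
  - by constructor 2; rewrite fts Fqp.
  - by constructor 3; rewrite fsts Fpqp.
move=> /mem6 xP /mem6 yP fxy.
case: xP => [[xE]|[xE]|[xE]|[[xE]|[xE]|[xE]]]; rewrite fxy;
  by case: yP => [[yE]|[yE]|[yE]|[[yE]|[yE]|[yE]]] -> //; rewrite xE yE.
Qed.

End LocalInjectivity.

Lemma hecke_hom_ext k n (f g : hecke_hom (cox_A k) (cox_A n)) :
  (forall i, f (hecke_gen _ i) = g (hecke_gen _ i)) -> f =1 g.
Proof.
move=> fg x; rewrite -(hecke_word_repr x); elim: (repr x) => [|i u IHu].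
  by rewrite hecke_word0 !gmulf1.
by rewrite hecke_word_cons !gmulfM fg IHu.
Qed.

(** The universal property of the presentation: the product of the images along a word respects the
    relations, so it may be evaluated on the chosen representative of a class. *)
Lemma hecke_hom_ex k n (h : 'I_k -> hecke (cox_A n)) :
    (forall i, (h i * h i = h i)%g) ->
    (forall i j : 'I_k, i.+1 < j -> (h i * h j = h j * h i)%g) ->
    (forall i j : 'I_k, i.+1 = j -> (h i * h j * h i = h j * h i * h j)%g) ->
  exists psi : hecke_hom (cox_A k) (cox_A n),
    forall i, psi (hecke_gen _ i) = h i.
Proof.
move=> h_idem h_comm h_braid.
pose ev (u : seq 'I_k) := (\prod_(i <- u) h i)%g.
have ev_cat u v : ev (u ++ v) = (ev u * ev v)%g by rewrite /ev big_cat.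
have ev_hecke u v : hecke_word (cox_A k) u = hecke_word (cox_A k) v -> ev u = ev v.
  move/hecke_wordP; apply: (@pres_eq_ind_cong _ _ (fun u v => ev u = ev v)) => //.
  - move=> {}u {}v [i|i j ij].
      by rewrite /ev !big_cons big_nil mulg1 h_idem.
    rewrite /= /ev; case: (cox_AP ij) => /= /orP[] ij';
      rewrite !big_cons big_nil !mulg1 ?mulgA.
    + exact: h_comm.
    + by rewrite (h_comm j i).
    + by apply: h_braid; apply/eqP.
    + by rewrite (h_braid j i) //; apply/eqP.
  - by move=> ? ? ? -> ->.
  - by move=> ? ? ? ?; rewrite !ev_cat => -> ->.
have ev_word u : ev (repr (hecke_word (cox_A k) u)) = ev u.
  by apply: ev_hecke; rewrite hecke_word_repr.
pose F (x : hecke (cox_A k)) := ev (repr x).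
have F1 : F 1%g = 1%g by rewrite /F (ev_word [::]) /ev big_nil.
have FM : {morph F : x y / (x * y)%g}.
  move=> x y; rewrite -{1}(hecke_word_repr x) -{1}(hecke_word_repr y).
  by rewrite -hecke_word_cat /F ev_word ev_cat.
pose psi : hecke_hom (cox_A k) (cox_A n) :=
  HB.pack_for (hecke_hom (cox_A k) (cox_A n)) F
    (isUMagmaMorphism.Build _ _ F (conj F1 FM)).
exists psi => i; rewrite [LHS](ev_word [:: i]) /ev big_cons big_nil mulg1 //.
Qed.

(** * Submonoids generated by two letters *)

Section TwoLetters.
Variable k : nat.
Local Notation hw := (@hecke_word 'I_k (cox_A k)).
Local Notation hs := (@hecke_gen 'I_k (cox_A k)).
Implicit Types i j : 'I_k.

Lemma two_letters_far i j u : (hs i * hs j = hs j * hs i)%g ->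
  {subset u <= [set i; j]%SET} ->
  hw u \in [:: 1; hs i; hs j; hs i * hs j]%g.
Proof.
move=> comm; elim/last_ind: u => [|u l IHu] uJ; first by rewrite mem_head.
have uJ' : {subset u <= [set i; j]%SET}.
  by move=> x xu; apply: uJ; rewrite mem_rcons inE xu orbT.
have lij : l \in [set i; j]%SET by apply: uJ; rewrite mem_rcons mem_head.
rewrite hecke_word_rcons; move: (IHu uJ').
rewrite !inE => /or4P[] /eqP ->; case/set2P: lij => ->;
  rewrite ?mul1g ?hecke_gen2 -?mulgA ?hecke_gen2 ?comm ?eqxx ?orbT //.
- by rewrite -comm mulgA hecke_gen2 comm eqxx !orbT.
Qed.

Lemma two_letters_near i j u :
  (hs i * hs j * hs i = hs j * hs i * hs j)%g ->
  {subset u <= [set i; j]%SET} ->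
  hw u \in [:: 1; hs i; hs j; hs i * hs j; hs j * hs i; hs i * hs j * hs i]%g.
Proof.
move=> braid; elim/last_ind: u => [|u l IHu] uJ; first by rewrite mem_head.
have uJ' : {subset u <= [set i; j]%SET}.
  by move=> x xu; apply: uJ; rewrite mem_rcons inE xu orbT.
have lij : l \in [set i; j]%SET by apply: uJ; rewrite mem_rcons mem_head.
rewrite hecke_word_rcons; move: (IHu uJ').
have e1 : (hs i * hs j * hs j = hs i * hs j)%g by rewrite -mulgA hecke_gen2.
have e2 : (hs j * hs i * hs i = hs j * hs i)%g by rewrite -mulgA hecke_gen2.
have e3 : (hs i * hs j * hs i * hs i = hs i * hs j * hs i)%g.
  by rewrite -mulgA hecke_gen2.
have e4 : (hs i * hs j * hs i * hs j = hs i * hs j * hs i)%g.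
  by rewrite braid -mulgA hecke_gen2.
rewrite !inE => /orP[|/or4P[|||/orP[]]] /eqP ->; case/set2P: lij => ->;
  by rewrite ?mul1g ?hecke_gen2 ?e3 ?e4 ?e1 ?e2 -?braid ?eqxx ?orbT.
Qed.

Lemma hecke_of_cox_parabolic J (w : cox (cox_A k)) : parabolic J w ->
  exists2 u, hecke_of_cox w = hw u & {subset u <= J}.
Proof.
case/parabolicP => u -> uJ; have [v [rv vu <-]] := cox_reduced u.
by exists v; [rewrite hecke_of_cox_word|move=> x /vu /uJ].
Qed.

Lemma parabolic_hecke_of_cox (J : {set 'I_k}) u : {subset u <= J} ->
  exists2 w : cox (cox_A k), parabolic J w & hecke_of_cox w = hw u.
Proof.
move=> uJ; have [v [rv vu <-]] := hecke_reduced u.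
exists (cox_word _ v); last exact: hecke_of_cox_word.
by apply/parabolicP; exists v => // x /vu /uJ.
Qed.

(** Through reduced words, the parabolic subgroup on a pair of letters corresponds to the Hecke
    classes of words in these letters. *)
Lemma locally_injectiveP n (phi : hecke_hom (cox_A k) (cox_A n)) :
  locally_injective phi <->
  (forall i j u v, i != j -> {subset u <= [set i; j]%SET} ->
    {subset v <= [set i; j]%SET} -> phi (hw u) = phi (hw v) -> hw u = hw v).
Proof.
split=> [phi_inj i j u v ij uJ vJ|phi_inj i j ij v w vJ wJ].
  have [x xJ xu] := parabolic_hecke_of_cox uJ.
  have [y yJ yv] := parabolic_hecke_of_cox vJ.
  by rewrite -xu -yv; apply: phi_inj ij _ _ xJ yJ.
have [u -> uJ] := hecke_of_cox_parabolic vJ.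
by have [u' -> u'J] := hecke_of_cox_parabolic wJ; apply: phi_inj ij uJ _.
Qed.

End TwoLetters.

Lemma hecke_top_orthogonal n (J1 J2 : {set 'I_n}) (h1 h2 : hecke (cox_A n)) :
    (forall i j : 'I_n, i \in J1 -> j \in J2 -> (i.+1 < j) || (j.+1 < i)) ->
  hecke_top J1 h1 -> hecke_top J2 h2 -> (h1 * h2 = h2 * h1)%g.
Proof.
move=> far [[u -> uJ] _] [[v -> vJ] _].
elim: u uJ => [|i u IHu] uJ; first by rewrite hecke_word0 mul1g mulg1.
rewrite hecke_word_cons -mulgA IHu => [|x xu]; last by apply: uJ; rewrite inE xu orbT.
rewrite !mulgA; congr (_ * _)%g.
have iJ : i \in J1 by apply: uJ; exact: mem_head.
elim: v vJ {IHu} => [|j v IHv] vJ; first by rewrite hecke_word0 mul1g mulg1.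
rewrite hecke_word_cons mulgA hecke_gen_comm; last first.
  by apply: far => //; apply: vJ; exact: mem_head.
by rewrite -!mulgA IHv // => x xv; apply: vJ; rewrite inE xv orbT.
Qed.

(** The right factor puts [j] into the support of the product. *)
Lemma hecke_top_neq_mul n (J1 J2 : {set 'I_n}) (h1 h2 : hecke (cox_A n)) j :
    hecke_top J1 h1 -> hecke_top J2 h2 -> j \in J2 -> j \notin J1 ->
  h1 <> (h1 * h2)%g.
Proof.
move=> [[u -> uJ] _] h2J jJ2 /negP jJ1 eq12; apply: jJ1; apply: uJ.
have [[v h2v vJ] absorb] := h2J.
have := absorb j jJ2; rewrite h2v in eq12 *; rewrite -hecke_word_rcons => vj.
move: eq12; rewrite -hecke_word_cat => /hecke_word_mem ->.
by rewrite mem_cat -(hecke_word_mem vj) mem_rcons mem_head orbT.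
Qed.

(* Consecutive blocks [b i, b i.+1) of positions; h i sorts the union of the
   blocks i and i.+1. *)
Section BlockHom.
Variables (k n : nat) (b : nat -> nat) (h : 'I_k -> hecke (cox_A n)).
Hypothesis b_lt : forall i, i <= k -> b i < b i.+1.
Hypothesis b_n : b k.+1 <= n.+1.
Hypothesis b_left : forall i, i.+1 < k -> b i.+1 - b i <= b i.+2 - b i.+1.
Hypothesis b_right : forall i, i.+1 < k -> b i.+3 - b i.+2 <= b i.+2 - b i.+1.
Hypothesis h_top : forall i : 'I_k, hecke_top (block n (b i) (b i.+2)) (h i).

Let b_le i j : i <= j -> j <= k.+1 -> b i <= b j.
Proof.
elim: j => [|j IHj]; first by case: i.
rewrite leq_eqVlt => /orP[/eqP -> //|ij] jk.
by apply: leq_trans (ltnW (b_lt jk)); apply: IHj => //; exact: ltnW.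
Qed.

Let far_comm (i j : 'I_k) : i.+1 < j -> (h i * h j = h j * h i)%g.
Proof.
move=> ij; apply: hecke_top_orthogonal (h_top i) (h_top j) => p q.
rewrite !inE => /andP[_ pi] /andP[jq _].
by have := @b_le i.+2 j ij; have := ltn_ord j; lia.
Qed.

Let overlap (i j : 'I_k) : i.+1 = j ->
  [/\ b i < b i.+1, b i.+1 < b i.+2, b i.+2 < b i.+3 & b i.+3 <= n.+1].
Proof.
move=> ij; have jk := ltn_ord j; split; try by apply: b_lt; lia.
by apply: leq_trans b_n; apply: b_le; lia.
Qed.

Let near_tops (i j : 'I_k) : i.+1 = j ->
  hecke_top (block n (b i) (b i.+3)) (h i * h j * h i)%g /\
  hecke_top (block n (b i) (b i.+3)) (h j * h i * h j)%g.
Proof.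
move=> ij; have [b0 b1 b2 b3] := overlap ij; have hi := h_top i; have hj := h_top j.
rewrite -ij in hj; have jk : i.+1 < k by rewrite ij ltn_ord.
split; first exact: (block_top_hgh b0 b1 b2 b3 hi hj (b_right jk)).
exact: (block_top_ghg b0 b1 b2 b3 hi hj (b_left jk)).
Qed.

Let near_braid (i j : 'I_k) : i.+1 = j -> (h i * h j * h i = h j * h i * h j)%g.
Proof. by move=> ij; have [] := near_tops ij; exact: hecke_top_uniq. Qed.

Lemma block_hom_ex : exists psi : hecke_hom (cox_A k) (cox_A n),
  forall i, psi (hecke_gen _ i) = h i.
Proof.
by apply: hecke_hom_ex => // i; apply: hecke_top_idem (h_top i).
Qed.

Variable psi : hecke_hom (cox_A k) (cox_A n).
Hypothesis psi_h : forall i, psi (hecke_gen _ i) = h i.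

(** Non-neighbouring indices give commuting elements, neither of whose supports contains the other.
    Neighbouring ones give a braided pair whose triple product absorbs every letter of the union,
    which neither double product does. *)
Lemma block_hom_locally_injective : locally_injective psi.
Proof.
apply/locally_injectiveP => i j u v; wlog ij : i j / i < j.
  move=> H ij; case: (ltngtP i j) => [lt|lt|/val_inj /eqP]; first exact: H.
    have -> : ([set i; j] = [set j; i])%SET by apply/setP => x; rewrite !inE orbC.
    by apply: H => //; rewrite eq_sym.
  by rewrite (negPf ij).
move=> ij' uJ vJ.
have hh (l : 'I_k) : (h l * h l = h l)%g by exact: hecke_top_idem (h_top l).
have [far|near] := ltnP i.+1 j.
  have comm : (hecke_gen (cox_A k) i * hecke_gen _ j = hecke_gen _ j * hecke_gen _ i)%g.
    by apply: hecke_gen_comm; rewrite far.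
  have jk := ltn_ord j.
  have b1 := @b_lt i; have b2 := @b_lt i.+1; have b3 := @b_lt j; have b4 := @b_lt j.+1.
  have b5 := @b_le i.+2 j far; have b6 := @b_le j.+2 k.+1.
  (* The first letters of the two blocks witness that neither support contains the other. *)
  have pn : b i < n by lia.
  have qn : b j < n by lia.
  apply: (commuting_pair_inj (hh i) (hh j) (far_comm far) _ _ _ (psi_h i) (psi_h j)).
  - by apply: (hecke_top_neq_mul (h_top i) (h_top j) (j := Ordinal qn));
      rewrite !inE /=; lia.
  - rewrite (far_comm far).
    by apply: (hecke_top_neq_mul (h_top j) (h_top i) (j := Ordinal pn));
      rewrite !inE /=; lia.
  - exact: gmulf1.
  - by rewrite gmulfM !psi_h.
  - exact: two_letters_far.
  - exact: two_letters_far.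
have {}near : i.+1 = j by lia.
have [b0 b1 b2 b3] := overlap near; have hi := h_top i; have hj := h_top j.
rewrite -near in hj; have [_ absorb] := (near_tops near).1.
have braid : (hecke_gen (cox_A k) i * hecke_gen _ j * hecke_gen _ i =
    hecke_gen _ j * hecke_gen _ i * hecke_gen _ j)%g.
  have /hecke_wordP := hecke_braid ij'.
  rewrite /= /cox_A_m (negPf ij') near eqxx /=.
  by rewrite !hecke_word_cons hecke_word0 !mulg1 !mulgA.
apply: (braided_pair_inj (hh i) (hh j) (near_braid near) _ _ _ (psi_h i) (psi_h j)).
- by move=> e; apply: (hg_not_top b0 b1 b2 b3 hi hj) => l lJ; rewrite e absorb.
- by move=> e; apply: (gh_not_top b0 b1 b2 b3 hi hj) => l lJ; rewrite e absorb.
- exact: gmulf1.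
- by rewrite gmulfM !psi_h.
- by rewrite gmulfM !psi_h.
- by rewrite !gmulfM !psi_h.
- exact: two_letters_near.
- exact: two_letters_near.
Qed.

(** Every letter is joined to the middle letter of its block, and the middle letters of neighbouring
    blocks are joined because these blocks overlap. A path in [J] thus lifts to a path of middle
    letters. *)
Lemma block_hom_connected : connected_hom psi.
Proof.
move=> J Jconn; set S := supp_hom psi J.
set e := (fun a c => [&& a \in S, c \in S & cox_edge (cox_A n) a c]).
have edgeE m (x y : 'I_m) : cox_edge (cox_A m) x y = (x.+1 == y) || (y.+1 == x).
  rewrite /cox_edge /= /cox_A_m; case: (eqVneq x y) => [->|_] /=; last by case: ifP.
  by rewrite orbb eqn_leq ltnn.
have e_sym : symmetric e by move=> x y; rewrite /e !edgeE orbC andbCA.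
have supp_h j : supp (psi (hecke_gen _ j)) = block n (b j) (b j.+2).
  by rewrite psi_h; exact: (hecke_top_supp (h_top j)).
have SP (j : 'I_k) (m : 'I_n) : j \in J -> b j <= m -> m.+1 < b j.+2 -> m \in S.
  move=> jJ bm mb; apply/bigcupP; exists j => //.
  by rewrite supp_h inE bm.
have run (p q : 'I_n) : p <= q -> (forall m : 'I_n, p <= m <= q -> m \in S) ->
    connect e p q.
  move: {2}(q - p) (erefl (q - p)) => d; elim: d q => [|d IHd] q qp pq allS.
    by rewrite (_ : p = q) //; apply: val_inj => /=; lia.
  have q1n : q.-1 < n by have := ltn_ord q; lia.
  apply: (connect_trans (y := Ordinal q1n)).
    by apply: IHd => /=; [lia|lia|move=> m ?; apply: allS; lia].
  apply: connect1; rewrite /e edgeE /= !allS /=; lia.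
have bk (j : 'I_k) : [/\ b j < b j.+1, b j.+1 < b j.+2 & b j.+2 <= n.+1].
  have jk := ltn_ord j; split; try by apply: b_lt; lia.
  by apply: leq_trans b_n; apply: b_le; lia.
have cn j : (b (j : 'I_k).+1).-1 < n by have [] := bk j; lia.
(* The letter c j crosses the boundary b j.+1 in the middle of the block of j. *)
pose c j := Ordinal (cn j).
have to_c (j : 'I_k) (p : 'I_n) : j \in J -> b j <= p -> p.+1 < b j.+2 ->
    connect e p (c j).
  move=> jJ bp pb; have [b0 b1 b2] := bk j; have [pc|cp] := leqP p (c j).
    by apply: run => // m; rewrite /c /=; move=> ?; apply: (SP j) => //; lia.
  rewrite (sym_connect_sym e_sym); apply: run => [|m]; first exact: ltnW.
  by rewrite /c /= => ?; apply: (SP j) => //; lia.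
have c_step (j l : 'I_k) : j \in J -> l \in J -> j.+1 = l -> connect e (c j) (c l).
  move=> jJ lJ jl; have [b0 b1 b2] := bk j; have [_ b3 b4] := bk l.
  rewrite -jl in b3 b4; apply: run => [|m]; rewrite /c /= -jl; first lia.
  move=> ?; have [mb|mb] := ltnP m.+1 (b j.+2); first by apply: (SP j) => //; lia.
  by apply: (SP l) => //; rewrite -jl; lia.
move=> p q /bigcupP[j jJ]; rewrite supp_h inE => /andP[bp pb].
case/bigcupP=> l lJ; rewrite supp_h inE => /andP[bq qb].
apply: connect_trans (to_c j p jJ bp pb) _.
suff cc : connect e (c j) (c l).
  by apply: connect_trans cc _; rewrite (sym_connect_sym e_sym); exact: to_c.
have /connectP[s] := Jconn j l jJ lJ.
elim: s j jJ {bp pb} => [|j' s IHs] j jJ /=; first by move=> _ ->.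
case/andP=> /and3P[_ j'J]; rewrite edgeE => jj' sp sl.
apply: (connect_trans (y := c j')); last exact: IHs.
case/orP: jj' => /eqP jj'; first exact: c_step.
by rewrite (sym_connect_sym e_sym); exact: c_step.
Qed.

End BlockHom.

(** * Block boundaries *)

(* The sequence a_i(lambda) for lambda = (D, ..., D, c, a) with k + 1 parts. *)
Definition bnd (k D c a i : nat) : nat :=
  if i is i'.+1 then (if i' < k then a + i' * D else a + k.-1 * D + c) else 0.

Section Boundaries.
Variables k D c a : nat.
Hypotheses (k2 : 2 <= k) (a0 : 0 < a) (c0 : 0 < c) (aD : a <= D) (cD : c <= D).
Local Notation b := (bnd k D c a).

Lemma bnd_lt i : i <= k -> b i < b i.+1.
Proof.
case: i => [|i] ik /=; first by rewrite (ltnW k2); lia.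
rewrite ik; have [ik'|ki] := ltnP i.+1 k; first by rewrite mulSn; lia.
have -> : i = k.-1 by lia.
lia.
Qed.

Lemma bnd_last : b k.+1 = a + k.-1 * D + c.
Proof. by rewrite /= ltnn. Qed.

Lemma bnd_left i : i.+1 < k -> b i.+1 - b i <= b i.+2 - b i.+1.
Proof.
move=> ik; rewrite /= ik (ltnW ik) mulSn; case: i ik => [|i] ik /=; first by lia.
by rewrite ifT ?mulSn; lia.
Qed.

Lemma bnd_right i : i.+1 < k -> b i.+3 - b i.+2 <= b i.+2 - b i.+1.
Proof.
move=> ik; rewrite /= ik (ltnW ik) mulSn.
have [ik'|ki] := ltnP i.+2 k; first by rewrite !mulSn; lia.
have -> : k.-1 = i.+1 by lia.
by rewrite mulSn; lia.
Qed.

(** Reading the boundaries from the right exchanges the two end lengths [a] and [c]; this is used to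
    arrange that the last part is the smallest. *)
Lemma bnd_rev i : i <= k.+1 -> bnd k D a c i = b k.+1 - b (k.+1 - i).
Proof.
rewrite bnd_last; case: i => [|i] ik; first by rewrite subn0 bnd_last subnn.
rewrite subSS /=; have [ik'|ki] := ltnP i k; last first.
  have -> : k - i = 0 by lia.
  by rewrite /=; move: (k.-1 * D); lia.
have -> : k - i = (k.-1 - i).+1 by lia.
rewrite /= ifT; last by lia.
have -> : k.-1 * D = (k.-1 - i) * D + i * D by rewrite -mulnDl; congr (_ * _); lia.
by move: ((k.-1 - i) * D) (i * D); lia.
Qed.

Variable lam : k.+1.-tuple nat.
Hypothesis lamE : lam = nseq k.-1 D ++ [:: c; a] :> seq nat.

(** The last part comes first in [a_], so the blocks have lengths a, then D repeated k-1 times, then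
    c. *)
Lemma a_E i : i <= k.+1 -> a_ lam i = b i.
Proof.
case: i => [|i] ik; first by [].
have nthE j : nth 0 lam j = if j < k.-1 then D else nth 0 [:: c; a] (j - k.-1).
  by rewrite lamE nth_cat size_nseq nth_nseq; case: (j < k.-1).
have partE : part lam k.+1 = a.
  have kk : (k < k.-1) = false by lia.
  have k1 : k - k.-1 = 1 by lia.
  by rewrite /part /= nthE kk k1.
have sumE m : m <= k.-1 -> \sum_(0 <= j < m) nth 0 lam j = m * D.
  move=> mk; rewrite -[in RHS](subn0 m) -sum_nat_const_nat.
  rewrite big_nat [RHS]big_nat; apply: eq_bigr => j jm.
  by rewrite nthE ifT //; lia.
rewrite /a_ /= partE big_add1 /=; have [ik'|ki] := ltnP i k.
  by rewrite /part sumE //; lia.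
have -> : i = k.-1.+1 by lia.
by rewrite big_nat_recr //= /part /= sumE // nthE ltnn subnn /= addnA.
Qed.

Lemma J_E n (i : 'I_k) : J_ lam n i.+1 = block n (b i) (b i.+2).
Proof.
have ik := ltn_ord i; apply/setP => j; rewrite !inE (@a_E i) ?(@a_E i.+2); lia.
Qed.

End Boundaries.

Lemma calA_form k m (lam : k.+1.-tuple nat) : 2 <= k ->
  in_calA lam m <-> exists D c a, [/\ 0 < a, a <= c, c <= D, a + k.-1 * D + c = m
    & lam = nseq k.-1 D ++ [:: c; a] :> seq nat].
Proof.
move=> k2; have sz := size_tuple lam.
rewrite /in_calA; have -> : k.+1 - 2 = k.-1 by lia.
split=> [/and4P[pos /(constantP 0)[D takeE] srt /eqP sumE]|].
  have dropE : exists c a, drop k.-1 lam = [:: c; a].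
    have : size (drop k.-1 lam) = 2 by rewrite size_drop sz; lia.
    by case: (drop _ _) => [|c [|a [|? ?]]] // _; exists c, a.
  have {dropE} [c [a dropE]] := dropE.
  have lamE : lam = nseq k.-1 D ++ [:: c; a] :> seq nat.
    by rewrite -{1}(cat_take_drop k.-1 lam) dropE takeE size_take sz ifT //; lia.
  move: pos srt sumE; rewrite lamE all_cat sumn_cat sumn_nseq /= => pos srt sumE.
  have nthE j : nth 0 (nseq k.-1 D ++ [:: c; a]) j =
      if j < k.-1 then D else nth 0 [:: c; a] (j - k.-1).
    by rewrite nth_cat size_nseq nth_nseq; case: (j < k.-1).
  move/(sortedP 0): srt; rewrite size_cat size_nseq /= => srt.
  exists D, c, a; split=> //; last by lia.
  - by case/and4P: pos.
  - have := srt k.-1; rewrite !nthE ltnn subnn ifF /=; last by lia.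
    by rewrite subSnn /= => H; apply: H; lia.
  - have := srt k.-2; have -> : k.-2.+1 = k.-1 by lia.
    have k12 : k.-2 < k.-1 by lia.
    by rewrite !nthE k12 ltnn subnn /= => H; apply: H; lia.
case=> D [c [a [a0 ac cD sumE lamE]]]; rewrite lamE; apply/and4P; split.
- by rewrite all_cat all_nseq /=; lia.
- rewrite take_cat size_nseq ltnn subnn take0 cats0.
  by apply/(constantP 0); exists D; rewrite size_nseq.
- apply/(sortedP 0) => j; rewrite size_cat size_nseq /= => jk.
  rewrite !nth_cat !size_nseq !nth_nseq.
  have [j1|j1] := ltnP j.+1 k.-1; first by rewrite (ltnW j1) /=.
  have [j2|j2] := ltnP j k.-1; first by rewrite (_ : _ - _ = 0) //=; lia.
  have -> : j = k.-1 by lia.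
  by rewrite subnn subSnn.
- by rewrite sumn_cat sumn_nseq /=; apply/eqP; lia.
Qed.

(** Edges join consecutive letters only, so a path from [p] to [q] cannot jump over a missing letter
    [m]. *)
Lemma connected_convex n (S : {set 'I_n}) : connected_set (cox_A n) S ->
  forall p m q : 'I_n, p \in S -> q \in S -> p <= m <= q -> m \in S.
Proof.
move=> Sconn p m q pS qS /andP[pm mq]; apply: contraT => mS.
have pm' : p < m.
  by rewrite ltn_neqAle pm andbT; apply: contraNneq mS => /val_inj <-.
have /connectP[s] := Sconn p q pS qS.
elim: s p pm' {pS pm} => [|r s IHs] p pm' /=.
  by move=> _ qp; move: mq pm'; rewrite qp; lia.
case/andP=> /and3P[_ rS e]; apply: IHs.
have rm : r != m by apply: contraTneq rS => ->.
move: e; rewrite /cox_edge /= /cox_A_m; case: ifP => [|_] /=.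
  by move=> /eqP <-.
case: ifP => //= e _; move: rm e; rewrite -val_eqE /=; lia.
Qed.

Lemma connected_block n (S : {set 'I_n}) : connected_set (cox_A n) S ->
  S != set0 -> exists x y, [/\ x.+1 < y, y <= n.+1 & S = block n x y].
Proof.
move=> Sconn /set0Pn[s sS].
have [l lS lmin] := @arg_minnP _ s (mem S) (fun i => val i) sS.
have [r rS rmax] := @arg_maxnP _ s (mem S) (fun i => val i) sS.
have lr := rmax l lS; have rn := ltn_ord r.
(* The letter [r] moves the positions r and r+1, so the half-open block ends at r+2. *)
exists l, r.+2; split; rewrite ?ltnS //.
apply/setP => m; rewrite inE ltnS ltnS; apply/idP/idP => [mS|lmr].
  by rewrite (lmin m mS) /=; exact: (rmax m mS).
by apply: (connected_convex Sconn lS rS).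
Qed.

(** * Classification *)

(* [x, y) and [x', y') overlap, the second to the right of the first, and the
   overlap is at least as long as either remainder. *)
Definition braid_overlap (x y x' y' : nat) : bool :=
  [&& x < x', x' < y, y < y', y' - y <= y - x' & x' - x <= y - x'].

(** Covering forces the first block to start at 0 and the last one to end at [N]. In an inner block
    the overlaps with the two neighbours are disjoint, and each is at least as long as the rest of
    the block; so they have equal length and fill the block. This common length is [D]. *)
Lemma increasing_blocks k N (x y : nat -> nat) :
    2 <= k -> 1 < N ->
    (forall i, i < k -> y i <= N) ->
    (forall i, i.+1 < k -> braid_overlap (x i) (y i) (x i.+1) (y i.+1)) ->
    (forall i j, i.+1 < j -> j < k -> y i <= x j) ->
    (forall m, m.+1 < N -> exists i, [/\ i < k, x i <= m & m.+1 < y i]) ->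
  exists D c a, [/\ [/\ 0 < a, 0 < c, a <= D & c <= D], a + k.-1 * D + c = N
    & forall i, i < k -> x i = bnd k D c a i /\ y i = bnd k D c a i.+2].
Proof.
move=> k2 N1 yN near far cover.
have x_mono i : i < k -> x 0 <= x i.
  elim: i => // i IHi ik; apply: leq_trans (IHi (ltnW ik)) _.
  by have /and5P[] := near i ik; lia.
have y_mono d : d < k -> y (k.-1 - d) <= y k.-1.
  elim: d => [|d IHd] dk; first by rewrite subn0.
  apply: leq_trans (IHd (ltnW dk)).
  have e : k.-1 - d = (k.-1 - d.+1).+1 by lia.
  have lt : (k.-1 - d.+1).+1 < k by lia.
  by rewrite e; have /and5P[] := near _ lt; lia.
have x0 : x 0 = 0.
  by have [i [ik xi _]] := cover 0 N1; have := x_mono i ik; lia.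
have yk : y k.-1 = N.
  have N2 : N.-2.+1 < N by lia.
  have [i [ik _ yi]] := cover N.-2 N2.
  have := @y_mono (k.-1 - i); rewrite (_ : k.-1 - (k.-1 - i) = i); last by lia.
  by have := yN k.-1; lia.
have [D DE] : exists D, D = y 0 - x 1 by exists (y 0 - x 1).
have step i : i.+1 < k -> y i - x i.+1 = D /\ x i.+1 = x 1 + i * D.
  elim: i => [|i IHi] ik; first by rewrite mul0n addn0 DE.
  have [yD xD] := IHi (ltnW ik).
  have := near i (ltnW ik); have := near i.+1 ik; have := far i i.+2 (ltnSn _) ik.
  by rewrite /braid_overlap mulSn; move: (i * D) yD xD; lia.
(* The end lengths are those of the pieces of the first and the last block outside their
   overlaps. *)
exists D, (N - y k.-2), (x 1).
have near0 := near 0 k2.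
have k1 : k.-2.+1 < k by lia.
have := near _ k1; have [ylast xlast] := step _ k1.
have -> : k.-2.+1 = k.-1 by lia.
have k12 : k.-1 = k.-2.+1 by lia.
have eD : k.-1 * D = D + k.-2 * D by rewrite k12 mulSn.
rewrite yk -k12 in ylast xlast * => nearl.
split; first by split; move: near0 nearl; rewrite /braid_overlap x0; lia.
  by move: nearl; rewrite /braid_overlap eD; move: (k.-2 * D) xlast ylast; lia.
move=> i ik; split.
  by case: i ik => [|i] ik //=; rewrite (ltnW ik) (step i ik).2.
rewrite /=; case: ifP => ik'.
  by have [e1 e2] := step i ik'; have := near i ik'; rewrite /braid_overlap mulSn; lia.
have -> : i = k.-1 by lia.
rewrite yk; move: nearl; rewrite /braid_overlap eD.
by move: (k.-2 * D) xlast ylast; lia.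
Qed.

(** Two blocks that overlap block i+1 on the same side share an end position of it, whereas blocks i
    and i+2 are disjoint. So the direction never turns, and a decreasing sequence becomes increasing
    when its indices are reversed. *)
Lemma ordered_blocks k N (x y : nat -> nat) :
    2 <= k -> 1 < N ->
    (forall i, i < k -> y i <= N) ->
    (forall i, i.+1 < k -> braid_overlap (x i) (y i) (x i.+1) (y i.+1) ||
                           braid_overlap (x i.+1) (y i.+1) (x i) (y i)) ->
    (forall i j, i.+1 < j -> j < k -> (y i <= x j) || (y j <= x i)) ->
    (forall m, m.+1 < N -> exists i, [/\ i < k, x i <= m & m.+1 < y i]) ->
  exists D c a, [/\ [/\ 0 < a, 0 < c, a <= D & c <= D], a + k.-1 * D + c = N
    & (forall i, i < k -> x i = bnd k D c a i /\ y i = bnd k D c a i.+2) \/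
      (forall i, i < k -> x i = bnd k D c a (k.-1 - i) /\
                          y i = bnd k D c a (k.-1 - i).+2)].
Proof.
move=> k2 N1 yN near far cover.
have turn i : i.+2 < k -> (x i < x i.+1) = (x i.+1 < x i.+2).
  move=> ik; have := near i (ltnW ik); have := near i.+1 ik.
  by have := far i i.+2 (ltnSn _) ik; rewrite /braid_overlap; lia.
have turns i : i.+1 < k -> (x i < x i.+1) = (x 0 < x 1).
  by elim: i => // i IHi ik; rewrite -turn // IHi // ltnW.
have [x01|x10] := boolP (x 0 < x 1).
  have up i : i.+1 < k -> braid_overlap (x i) (y i) (x i.+1) (y i.+1).
    move=> ik; have := near i ik; have := turns i ik; rewrite x01.
    by rewrite /braid_overlap; lia.
  have mono i j : i <= j -> j < k -> x i <= x j.
    elim: j => [|j IHj]; first by case: i.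
    rewrite leq_eqVlt => /orP[/eqP -> //|ij] jk.
    by have := IHj ij (ltnW jk); have /and5P[] := up j jk; lia.
  have [|D [c [a [? ? xyE]]]] := increasing_blocks k2 N1 yN up _ cover.
    move=> i j ij jk; have := far i j ij jk; have := mono i.+1 j (ltnW ij) jk.
    have /and5P[] := up i (ltn_trans ij jk).
    have : x j < y j; last by lia.
    have j0 : j = j.-1.+1 by lia.
    have jk' : j.-1.+1 < k by lia.
    by have := up j.-1 jk'; rewrite -j0 /braid_overlap; lia.
  by exists D, c, a; split=> //; left.
have down i : i.+1 < k -> braid_overlap (x i.+1) (y i.+1) (x i) (y i).
  move=> ik; have := near i ik; have := turns i ik; rewrite (negPf x10).
  by rewrite /braid_overlap; lia.
have mono i j : i <= j -> j < k -> x j <= x i.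
  elim: j => [|j IHj]; first by case: i.
  rewrite leq_eqVlt => /orP[/eqP -> //|ij] jk.
  by have := IHj ij (ltnW jk); have /and5P[] := down j jk; lia.
pose x' i := x (k.-1 - i); pose y' i := y (k.-1 - i).
have [i ik|i ik|i j ij jk|m mN|D [c [a [? ? xyE]]]] :=
    @increasing_blocks k N x' y' k2 N1.
- by apply: yN; lia.
- have e : k.-1 - i = (k.-1 - i.+1).+1 by lia.
  by rewrite /x' /y' e; apply: down; lia.
- have ji : (k.-1 - j).+1 < k.-1 - i by lia.
  have ik : k.-1 - i < k by lia.
  rewrite /x' /y'; move: (k.-1 - j) (k.-1 - i) ji ik => j' i' ji ik {i j ij jk}.
  have := far j' i' ji ik; have := mono j'.+1 i' (ltnW ji) ik.
  have /and5P[] := down j' (ltn_trans ji ik).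
  have : x i' < y i'; last by lia.
  have i0 : i' = i'.-1.+1 by lia.
  have ik' : i'.-1.+1 < k by lia.
  by have := down i'.-1 ik'; rewrite -i0 /braid_overlap; lia.
- have [i [ik xi yi]] := cover m mN; exists (k.-1 - i).
  by rewrite /x' /y' (_ : k.-1 - (k.-1 - i) = i); [split=> //|]; lia.
exists D, c, a; split=> //; right=> i ik.
have /xyE : k.-1 - i < k by lia.
by rewrite /x' /y' (_ : k.-1 - (k.-1 - i) = i) //; lia.
Qed.

Lemma not_reduced_word3 k (i j : 'I_k) : (i.+1 == j) || (j.+1 == i) ->
  hecke_word (cox_A k) [:: i; j; i] <> hecke_word (cox_A k) [:: i; j].
Proof.
move=> near e.
have /hecke_descent : (hecke_word (cox_A k) [:: i; j] * hecke_gen _ i =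
    hecke_word (cox_A k) [:: i; j])%g by rewrite -hecke_word_rcons.
case/orP: near => /eqP ij; rewrite /= -ij.
  rewrite bubble_l (@bubble_far i.+1 _ i) ?ltnSn // !bubble_l bubble_r.
  by rewrite bubble_far ?ltnSn ?orbT //; lia.
rewrite (@bubble_far j _ j.+2) ?ltnSn ?orbT // bubble_r !bubble_r bubble_l.
by rewrite bubble_far ?ltnSn //; lia.
Qed.

(** * Constraints imposed by local injectivity *)

Section LocallyInjective.
Variables (k n : nat) (phi : hecke_hom (cox_A k) (cox_A n)).
Hypothesis phi_inj : locally_injective phi.
Local Notation hs := (@hecke_gen 'I_k (cox_A k)).
Local Notation hw := (@hecke_word 'I_k (cox_A k)).
Variables (i j : 'I_k) (x y x' y' : nat).
Hypothesis ij : i != j.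
Hypothesis phi_i : hecke_top (block n x y) (phi (hs i)).
Hypothesis phi_j : hecke_top (block n x' y') (phi (hs j)).

Let inj2 u v : {subset u <= [:: i; j]} -> {subset v <= [:: i; j]} ->
  phi (hw u) = phi (hw v) -> hw u = hw v.
Proof.
have sub s : {subset s <= [:: i; j]} -> {subset s <= [set i; j]%SET}.
  by move=> sub l /sub; rewrite !inE.
move=> /sub uJ /sub vJ; have /locally_injectiveP inj := phi_inj.
exact: inj ij uJ vJ.
Qed.

Let phi2 a b : phi (hw [:: a; b]) = (phi (hs a) * phi (hs b))%g.
Proof. by rewrite hecke_word_cons gmulfM. Qed.

Let phi3 a b c : phi (hw [:: a; b; c]) = (phi (hs a) * phi (hs b) * phi (hs c))%g.
Proof. by rewrite !hecke_word_cons hecke_word0 mulg1 !gmulfM mulgA. Qed.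

(** Nesting makes the larger block absorb the smaller, so that s_i s_j and s_j would have the same
    image although their supports differ. *)
Lemma locally_injective_not_nested : ~~ ((x' <= x) && (y <= y')).
Proof.
apply/negP => /andP[xx yy].
have sub : block n x y \subset block n x' y'.
  by apply/subsetP => l; rewrite !inE; lia.
have := hecke_top_subset phi_i phi_j sub.
rewrite -phi2 => /(@inj2 _ [:: j]) e.
have {}e : hw [:: i; j] = hw [:: j].
  by apply: e => l; rewrite !inE => -> //; rewrite ?orbT.
by have := hecke_word_mem e i; rewrite !inE eqxx (negPf ij).
Qed.

Lemma locally_injective_far : y' <= n.+1 -> (i.+1 < j) || (j.+1 < i) ->
  x < x' -> y < y' -> y <= x'.
Proof.
move=> yn' far xx yy; rewrite leqNgt; apply/negP => lt.
apply: (blocks_not_comm xx lt yy yn' phi_i phi_j).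
by rewrite -!gmulfM hecke_gen_comm.
Qed.

Lemma locally_injective_near : y' <= n.+1 -> (i.+1 == j) || (j.+1 == i) ->
  x < x' -> y < y' -> braid_overlap x y x' y'.
Proof.
move=> yn' near xx yy.
(* For disjoint blocks the images commute, and the distinct elements s_i s_j s_i and s_i s_j would
   have the same image. *)
have lt : x' < y.
  rewrite ltnNge; apply/negP => yx'; apply: (not_reduced_word3 near).
  apply: inj2; try by move=> l; rewrite !inE; case: (l == i); case: (l == j).
  rewrite phi3 phi2 -mulgA (hecke_top_orthogonal _ phi_j phi_i) => [|p q].
    by rewrite mulgA (hecke_top_idem phi_i).
  by rewrite !inE; lia.
have [] := blocks_braid xx lt yy yn' phi_i phi_j.
  rewrite -!phi3; congr (phi _).
  have := hecke_braid ij; move/hecke_wordP.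
  by rewrite /= /cox_A_m (negPf ij) near.
by rewrite /braid_overlap xx lt yy => -> ->.
Qed.

End LocallyInjective.

(** The image of a generator is idempotent with connected support, hence the longest element of an
    interval. The support is nonempty: otherwise the generator and 1 would have the same image,
    against injectivity on a pair of indices, which exists as k > 1. *)
Lemma supp_gen_block k n (phi : hecke_hom (cox_A k) (cox_A n)) (i : 'I_k) :
    1 < k -> locally_injective phi -> connected_hom phi ->
  exists x y, [/\ x.+1 < y, y <= n.+1
    & hecke_top (block n x y) (phi (hecke_gen _ i))].
Proof.
move=> k2 phi_inj phi_conn.
have top : hecke_top (supp (phi (hecke_gen _ i))) (phi (hecke_gen _ i)).
  by apply: hecke_idem_top; rewrite -gmulfM hecke_gen2.
have single : connected_set (cox_A k) [set i]%SET.
  by move=> p q /set1P -> /set1P ->; exact: connect0.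
have := phi_conn _ single; rewrite /supp_hom big_set1 => conn.
have [|x [y [xy yn sE]]] := connected_block conn; last first.
  by exists x, y; split=> //; move: top; rewrite {1}sE.
apply/negP => /eqP s0; have [[u uE uJ] _] := top; rewrite s0 in uJ.
have phi1 : phi (hecke_word _ [:: i]) = phi (hecke_word _ [::]).
  rewrite [LHS]uE hecke_word0 gmulf1; case: u uJ {uE} => // l u /(_ l (mem_head _ _)).
  by rewrite inE.
have [j ij] : exists j : 'I_k, i != j.
  have [i0|i0] := eqVneq (i : nat) 0.
    by exists (Ordinal k2); rewrite -val_eqE /= i0.
  by exists (Ordinal (ltnW k2)); rewrite -val_eqE.
move/locally_injectiveP: phi_inj => /(_ i j [:: i] [::] ij) inj.
have : hecke_word (cox_A k) [:: i] = hecke_word _ [::].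
  by apply: inj => // l; rewrite !inE => ->.
by move/hecke_word_mem/(_ i); rewrite inE eqxx.
Qed.

(** * Diagram automorphisms and conclusion *)

Lemma diagram_hom_ex n (s : {perm 'I_n}) :
    (forall i j, cox_A n (s i) (s j) = cox_A n i j) ->
  exists d : hecke_hom (cox_A n) (cox_A n),
    forall i, d (hecke_gen _ i) = hecke_gen _ (s i).
Proof.
move=> sM; apply: hecke_hom_ex => [i|i j ij|i j ij]; first exact: hecke_gen2.
  have ij' : i != j by rewrite -val_eqE /=; lia.
  have sij : s i != s j by rewrite (inj_eq perm_inj).
  have /hecke_wordP := hecke_braid sij.
  rewrite sM /= /cox_A_m (negPf ij') ifN; last by lia.
  by rewrite !hecke_word_cons hecke_word0 !mulg1.
have ij' : i != j by rewrite -val_eqE /=; lia.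
have sij : s i != s j by rewrite (inj_eq perm_inj).
have /hecke_wordP := hecke_braid sij.
rewrite sM /= /cox_A_m (negPf ij') ij eqxx /=.
by rewrite !hecke_word_cons hecke_word0 !mulg1 !mulgA.
Qed.

Lemma diagram_top n (s : {perm 'I_n}) (d : hecke_hom (cox_A n) (cox_A n)) J h :
    (forall i, d (hecke_gen _ i) = hecke_gen _ (s i)) ->
  hecke_top J h -> hecke_top (s @: J) (d h).
Proof.
move=> ds [[u -> uJ] absorb]; split.
  exists (map s u); last by move=> _ /mapP[i iu ->]; apply/imset_f/uJ.
  elim: u {uJ absorb} => [|i u IHu]; first by rewrite hecke_word0 gmulf1.
  by rewrite /= !hecke_word_cons gmulfM ds IHu.
by move=> _ /imsetP[i iJ ->]; rewrite -ds -gmulfM absorb.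
Qed.

Lemma cox_A_rev n (i j : 'I_n) : cox_A n (rev_ord i) (rev_ord j) = cox_A n i j.
Proof.
have ni := ltn_ord i; have nj := ltn_ord j.
rewrite /= /cox_A_m (inj_eq rev_ord_inj) /=; case: ifP => // _.
by congr (if _ then _ else _); lia.
Qed.

Lemma rev_block n x y : x <= n.+1 -> y <= n.+1 ->
  perm (@rev_ord_inj n) @: block n x y = block n (n.+1 - y) (n.+1 - x).
Proof.
move=> xn yn; apply/setP => j; have nj := ltn_ord j.
rewrite -{1}(rev_ordK j) -[rev_ord (rev_ord j)](permE (@rev_ord_inj n)).
rewrite mem_imset; last exact: perm_inj.
by rewrite !inE /=; lia.
Qed.

Lemma psi_ex k n (lam : k.+1.-tuple nat) : 2 <= k -> in_calA lam n.+1 ->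
  exists psi : hecke_hom (cox_A k) (cox_A n),
    [/\ is_psi lam psi, locally_injective psi & connected_hom psi].
Proof.
move=> k2 /(calA_form _ _ k2)[D [c [a [a0 ac cD sumE lamE]]]].
pose h (i : 'I_k) := hecke_of_cox (w0 (cox_A n) (J_ lam n i.+1)).
have c0 := leq_trans a0 ac; have aD := leq_trans ac cD.
have h_top (i : 'I_k) : hecke_top (block n (bnd k D c a i) (bnd k D c a i.+2)) (h i).
  by rewrite -(J_E k2 a0 c0 aD cD lamE); exact: hecke_w0_top.
have b_lt := bnd_lt k2 a0 c0 aD cD.
have b_n : bnd k D c a k.+1 <= n.+1 by rewrite bnd_last sumE.
have b_left := bnd_left k2 a0 c0 aD cD; have b_right := bnd_right k2 a0 c0 aD cD.
have [psi psi_h] := block_hom_ex b_lt b_n b_left b_right h_top.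
exists psi; split=> //.
  exact: (block_hom_locally_injective b_lt b_n b_left b_right h_top psi_h).
exact: (block_hom_connected b_lt b_n h_top psi_h).
Qed.

(** A homomorphism is determined by the images of the generators, and these idempotents by their
    supports. Hence it suffices to compare blocks after relabelling the generators by [s] and
    [t]. *)
Lemma hom_eq_psi k n (phi : hecke_hom (cox_A k) (cox_A n)) D c a
    (s : {perm 'I_k}) (t : {perm 'I_n}) :
    2 <= k -> 0 < a -> a <= c -> c <= D -> a + k.-1 * D + c = n.+1 ->
    (forall i j, cox_A k (s i) (s j) = cox_A k i j) ->
    (forall i j, cox_A n (t i) (t j) = cox_A n i j) ->
    (forall i : 'I_k, hecke_top
      (t @: block n (bnd k D c a (s i)) (bnd k D c a (s i).+2))
      (phi (hecke_gen _ i))) ->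
  exists (lam : k.+1.-tuple nat)
    (psi : hecke_hom (cox_A k) (cox_A n))
    (d' : hecke_hom (cox_A k) (cox_A k))
    (d : hecke_hom (cox_A n) (cox_A n)),
    [/\ in_calA lam n.+1, is_psi lam psi,
        diagram_automorphism d', diagram_automorphism d
      & phi =1 d \o psi \o d'].
Proof.
move=> k2 a0 ac cD sumE sM tM phi_top.
have sz : size (nseq k.-1 D ++ [:: c; a]) == k.+1.
  by rewrite size_cat size_nseq /=; lia.
pose lam := Tuple sz.
have lamA : in_calA lam n.+1 by apply/(calA_form _ _ k2); exists D, c, a.
have [psi [psiE _ _]] := psi_ex k2 lamA.
have [d' d'E] := diagram_hom_ex sM; have [d dE] := diagram_hom_ex tM.
exists lam, psi, d', d; split=> //; [by exists s|by exists t|].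
pose g : hecke_hom (cox_A k) (cox_A n) := d \o psi \o d'.
have -> : d \o psi \o d' = g by [].
apply: hecke_hom_ext => i; apply: hecke_top_uniq (phi_top i) _.
rewrite [g _]/= d'E psiE; apply: (diagram_top dE).
have c0 := leq_trans a0 ac; have aD := leq_trans ac cD.
rewrite -(J_E (lam := lam) k2 a0 c0 aD cD) //; exact: hecke_w0_top.
Qed.

(** Non-nesting orders any two blocks consistently at both ends, and full support is the covering
    condition of [ordered_blocks]. The right-to-left case is absorbed by the reversal of the domain
    diagram. *)
Lemma hom_blocks k n (phi : hecke_hom (cox_A k) (cox_A n)) :
    2 <= k -> k <= n ->
    locally_injective phi -> connected_hom phi -> fully_supported phi ->
  exists D c a (s : {perm 'I_k}),
    [/\ [/\ 0 < a, 0 < c, a <= D & c <= D], a + k.-1 * D + c = n.+1,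
        forall i j, cox_A k (s i) (s j) = cox_A k i j
      & forall i : 'I_k, hecke_top
          (block n (bnd k D c a (s i)) (bnd k D c a (s i).+2))
          (phi (hecke_gen _ i))].
Proof.
move=> k2 kn phi_inj phi_conn phi_full.
pose good (i : 'I_k) (p : nat * nat) := [/\ p.1.+1 < p.2, p.2 <= n.+1
    & hecke_top (block n p.1 p.2) (phi (hecke_gen _ i))].
(* Blocks are indexed by all naturals to fit [ordered_blocks]; the value (0, 0) is taken only at
   indices that name no generator. *)
have /choice[f fP] : forall m, exists p, forall i : 'I_k, i = m :> nat -> good i p.
  move=> m; have [mk|km] := ltnP m k.
    have [x [y xyP]] := supp_gen_block (Ordinal mk) k2 phi_inj phi_conn.
    by exists (x, y) => i im; have -> : i = Ordinal mk by exact: val_inj.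
  by exists (0, 0) => i; have := ltn_ord i; lia.
have {}fP (i : 'I_k) : good i (f i) by exact: fP.
pose x m := (f m).1; pose y m := (f m).2.
have order (i j : 'I_k) : i != j ->
    (x i < x j) && (y i < y j) || (x j < x i) && (y j < y i).
  move=> ij; have [xyi yi ti] := fP i; have [xyj yj tj] := fP j.
  have := locally_injective_not_nested phi_inj ij ti tj.
  have := locally_injective_not_nested phi_inj (_ : j != i) tj ti.
  by rewrite eq_sym => /(_ ij); rewrite /x /y; lia.
have n1 : 1 < n.+1 by lia.
have [m mk|m mk|l m lm mk|m mn|D [c [a [bnds sumE xyE]]]] :=
    @ordered_blocks k n.+1 x y k2 n1.
- by have [] := fP (Ordinal mk).
- pose i := Ordinal (ltnW mk); pose j := Ordinal mk.
  have ij : i != j by rewrite -val_eqE /=; lia.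
  have [xyi yi ti] := fP i; have [xyj yj tj] := fP j.
  apply/orP; case/orP: (order i j ij) => /andP[xx yy]; [left|right].
    by apply: (locally_injective_near phi_inj ij ti tj) => //=; rewrite eqxx.
  by apply: (locally_injective_near phi_inj (_ : j != i) tj ti);
    rewrite //= ?eqxx ?orbT // eq_sym.
- pose i := Ordinal (ltn_trans (ltnSn l) (ltn_trans lm mk)); pose j := Ordinal mk.
  have ij : i != j by rewrite -val_eqE /=; lia.
  have [xyi yi ti] := fP i; have [xyj yj tj] := fP j.
  apply/orP; case/orP: (order i j ij) => /andP[xx yy]; [left|right].
    by apply: (locally_injective_far ti tj) => //=; rewrite lm.
  by apply: (locally_injective_far tj ti) => //=; rewrite lm orbT.
- have mn' : m < n by lia.
  have : Ordinal mn' \in supp_hom phi [set: 'I_k] by rewrite phi_full inE.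
  case/bigcupP => i _; have [_ _ ti] := fP i; rewrite (hecke_top_supp ti) inE.
  by case/andP => xm my; exists i.
have [x_up|x_down] := xyE.
  exists D, c, a, 1%g; split=> // [i j|i]; first by rewrite !perm1.
  by rewrite perm1; have [_ _] := fP i; have [<- <-] := x_up i (ltn_ord i).
exists D, c, a, (perm (@rev_ord_inj k)); split=> // [i j|i].
  by rewrite !permE cox_A_rev.
rewrite permE; have -> : rev_ord i = k.-1 - i :> nat by rewrite /=; lia.
by have [_ _] := fP i; have [<- <-] := x_down i (ltn_ord i).
Qed.

Theorem theorem5p1 (n k : nat) (hk : 2 <= k) (hkn : k <= n) :
  (forall lam : k.+1.-tuple nat, in_calA lam n.+1 ->
     exists psi : hecke_hom (cox_A k) (cox_A n),
       [/\ is_psi lam psi, locally_injective psi & connected_hom psi]) /\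
  (forall phi : hecke_hom (cox_A k) (cox_A n),
     locally_injective phi -> connected_hom phi -> fully_supported phi ->
     exists (lam : k.+1.-tuple nat)
       (psi : hecke_hom (cox_A k) (cox_A n))
       (d' : hecke_hom (cox_A k) (cox_A k))
       (d : hecke_hom (cox_A n) (cox_A n)),
       [/\ in_calA lam n.+1, is_psi lam psi,
           diagram_automorphism d', diagram_automorphism d
         & phi =1 d \o psi \o d']).
Proof.
split=> [lam|phi phi_inj phi_conn phi_full]; first exact: psi_ex.
have [D [c [a [s [[a0 c0 aD cD] sumE sM phi_top]]]]] :=
  hom_blocks hk hkn phi_inj phi_conn phi_full.
have [ac|ca] := leqP a c.
  apply: (hom_eq_psi (s := s) (t := 1%g) hk a0 ac cD sumE sM) => [i j|i].
    by rewrite !perm1.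
  have im1 (J : {set 'I_n}) : (1%g : {perm 'I_n}) @: J = J.
    by apply/setP => j; rewrite -{1}(perm1 j) mem_imset //; exact: perm_inj.
  by rewrite im1.
(* If c < a, reversing both diagrams exchanges the end lengths, so that the last two parts, now [a]
   and [c], are in weakly decreasing order. *)
pose r := perm (@rev_ord_inj k).
apply: (@hom_eq_psi _ _ _ D a c (s * r)%g (perm (@rev_ord_inj n))) => //.
- exact: ltnW.
- by lia.
- by move=> i j; rewrite !permM !permE cox_A_rev sM.
- by move=> i j; rewrite !permE cox_A_rev.
move=> i; have si := ltn_ord (s i).
have N j : j <= k.+1 -> bnd k D a c j = n.+1 - bnd k D c a (k.+1 - j).
  by move=> jk; rewrite (bnd_rev hk a0 c0 aD cD jk) bnd_last sumE.
have N' j : j <= k.+1 -> bnd k D c a j <= n.+1.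
  by move=> jk; rewrite (bnd_rev hk c0 a0 cD aD jk) bnd_last; lia.
rewrite permM permE; have -> : rev_ord (s i) = k - (s i).+1 :> nat by [].
rewrite !N; [|lia|lia].
rewrite rev_block ?leq_subr // !subKn; [|apply: N'; lia|apply: N'; lia].
have -> : k.+1 - (k - (s i).+1).+2 = s i by lia.
by have -> : k.+1 - (k - (s i).+1) = (s i).+2 by lia.
Qed.
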